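(* Let $q\ge 1$ be a real number. For a densely defined closable operator $S$ in a nonzero complex Hilbert space $\mathcal H$, with closure $\bar S$, consider the following conditions. (i) $\mathcal H$ is separable and there is an orthonormal basis of $\mathcal H$ of the form $\{e_n\}_{n=0}^\infty$, contained in $\mathcal D(\bar S)$ and such that $\bar S e_n=\sqrt{[n+1]_q}\,e_{n+1}$ for $n=0,1,\dots$ (ii) $S$ is irreducible, satisfies $(\mathcal O_{q,\mathcal D})$ with some $\mathcal D$ which is invariant for $S$ and $S^*$ and is a core of $S$, and $S$ is a subnormal operator having a tight and $*$-tight normal extension. (iii) $S$ is irreducible and satisfies $(\mathcal O_{q,\mathcal D})$ with some $\mathcal D$ which is a core of both $S$ and $S^*$. (iv) $S$ is irreducible, satisfies $(\mathcal O_{q,\mathrm w})$, and $\mathcal D(\bar S)=\mathcal D(S^* )$. (v) $S$ is irreducible, satisfies $(\mathcal O_{q,\mathrm w})$ with $\mathcal D(\bar S)\cap\mathcal D(S^* )$ dense in $\mathcal H$, $\ker S^*\neq\{0\}$, and $\bar S^n(\ker S^* )\subset\mathcal D(\bar S)\cap\mathcal D(S^* )$ for $n=0,1,\dots$ Then (i) $\Rightarrow$ (ii) $\Rightarrow$ (iii) $\Rightarrow$ (iv) $\Rightarrow$ (v) $\Rightarrow$ (i).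
   Context: Operators are linear and may be unbounded; $\mathcal D(A)$ is the domain of $A$, $A^*$ the Hilbert space adjoint, $\bar A$ the closure. A linear subspace $\mathcal D\subset\mathcal D(A)$ is invariant for $A$ if $A\mathcal D\subset\mathcal D$. A linear subspace $\mathcal D\subset\mathcal D(\bar A)$ is a core of a closable operator $A$ if the closure of $\bar A|_{\mathcal D}$ is $\bar A$. For a non-negative integer $n$, $[n]_q=1+q+\cdots+q^{n-1}$ (with $[0]_q=0$). $(\mathcal O_{q,\mathcal D})$: $S$ is closable, $\mathcal D$ is a dense linear subspace of $\mathcal H$, $\mathcal D\subset\mathcal D(S^*\bar S)\cap\mathcal D(\bar SS^* )$, and $S^*\bar Sf-q\bar SS^*f=f$ for all $f\in\mathcal D$. $(\mathcal O_{q,\mathrm w})$: $\langle Sf,Sg\rangle-q\langle S^*f,S^*g\rangle=\langle f,g\rangle$ for all $f,g\in\mathcal D(S)\cap\mathcal D(S^* )$. A densely defined operator $N$ is normal if $\mathcal D(N)=\mathcal D(N^* )$ and $\|Nf\|=\|N^*f\|$ for $f\in\mathcal D(N)$. A densely defined operator $S$ in $\mathcal H$ is subnormal if there are a Hilbert space $\mathcal K$ containing $\mathcal H$ isometrically and a normal operator $N$ in $\mathcal K$ with $S\subset N$; $N$ is then a normal extension of $S$. It is tight if $\mathcal D(\bar S)=\mathcal D(\bar N)\cap\mathcal H$ and $*$-tight if $\mathcal D(N^* )\cap\mathcal H=\mathcal D(S^* )$. A closed subspace $\mathcal L$ of $\mathcal H$ with orthogonal projection $P$ reduces an operator $A$ if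 $PA\subset AP$; $A$ is irreducible if no closed subspace other than $\{0\}$ and $\mathcal H$ reduces it.
   Formalization: Condition (i) additionally requires the linear span of {e_n} to be a core of S; irreducibility in (ii)–(v), invariance of D for S in (ii), and the relation (O_{q,w}) in (iv) and (v) are imposed on the closure of S instead of on S itself. *)

(* Defs.v *)
(* MathComp / MathComp-Analysis; complex scalars are R[i] with R : realType. *)
From HB Require Import structures.
From mathcomp Require Import all_boot all_order all_algebra sesquilinear.
From mathcomp Require Import complex.
From mathcomp Require Import all_classical all_reals all_analysis.

Set Implicit Arguments.
Unset Strict Implicit.
Unset Printing Implicit Defensive.

Import Order.TTheory GRing.Theory Num.Theory.
Import numFieldNormedType.Exports.

Local Open Scope classical_set_scope.
Local Open Scope ring_scope.
Local Open Scope complex_scope.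

(* The inner product is linear in its first argument and conjugate-linear in
   its second one. *)
HB.mixin Record CompleteNormedModule_isHilbert (R : realType) H
    of CompleteNormedModule R[i] H := {
  hdot : {dot H for (@Num.conj R[i])};
  sqr_norm_hdot : forall x : H, `|x| ^+ 2 = hdot x x
}.

#[short(type="hilbertType")]
HB.structure Definition Hilbert (R : realType) :=
  {H of CompleteNormedModule_isHilbert R H & CompleteNormedModule R[i] H}.

(* A partially defined map: the values of [op_fun] outside [dom] are junk, so
   operators are only ever compared through [op_sub] and [op_eq]. *)
Record operator (R : realType) (H : hilbertType R) := Operator {
  dom : set H;
  op_fun :> H -> H
}.

Section Operators.
Context {R : realType} {H : hilbertType R}.
Implicit Types (A B S : operator H) (D L : set H) (e : nat -> H).

Definition linear_subspace D :=
  D 0 /\ forall (a : R[i]) (x y : H), D x -> D y -> D (a *: x + y).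

Definition linear_operator A :=
  linear_subspace (dom A) /\
  forall (a : R[i]) (x y : H), dom A x -> dom A y ->
    A (a *: x + y) = a *: A x + A y.

Definition op_sub A B :=
  dom A `<=` dom B /\ forall x, dom A x -> A x = B x.

Definition op_eq A B := op_sub A B /\ op_sub B A.

Definition comp_op A B : operator H :=
  Operator [set x | dom B x /\ dom A (B x)] (fun x => A (B x)).

Definition id_op : operator H := Operator setT id.

Definition pow_op A n : operator H := iter n (comp_op A) id_op.

Definition restrict_op A D : operator H := Operator (dom A `&` D) A.

Definition ker_op A : set H := [set x | dom A x /\ A x = 0].

Definition graph A : set (H * H) := [set p | dom A p.1 /\ p.2 = A p.1].

Definition closable A :=
  forall x y z, closure (graph A) (x, y) -> closure (graph A) (x, z) -> y = z.

(* Meaningful for closable A: its graph is then the closure of that of A. *)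
Definition closure_op A : operator H :=
  Operator [set x | exists y, closure (graph A) (x, y)]
           (fun x => xget 0 [set y | closure (graph A) (x, y)]).

(* Meaningful for densely defined A: z below is then unique. *)
Definition adj_op A : operator H :=
  let is_adj y z := forall x, dom A x -> hdot (A x) y = hdot x z in
  Operator [set y | exists z, is_adj y z] (fun y => xget 0 [set z | is_adj y z]).

Definition densely_defined A := dense (dom A).

Definition invariant A D := [/\ linear_subspace D, D `<=` dom A & A @` D `<=` D].

Definition core A D :=
  [/\ linear_subspace D, D `<=` dom (closure_op A) &
      op_eq (closure_op (restrict_op (closure_op A) D)) (closure_op A)].

(* Total and single-valued when L is a closed linear subspace. *)
Definition oproj L (x : H) : H :=
  xget 0 [set y | L y /\ forall z, L z -> hdot (x - y) z = 0].

Definition reduces L A :=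
  let P := Operator setT (oproj L) in op_sub (comp_op P A) (comp_op A P).

Definition irreducible_op A :=
  forall L, linear_subspace L -> closed L -> reduces L A ->
    L = [set 0] \/ L = setT.

Definition normal_op A :=
  [/\ linear_operator A, densely_defined A, dom A = dom (adj_op A) &
      forall x, dom A x -> `|A x| = `|adj_op A x|].

Definition separable_space := exists2 A : set H, countable A & dense A.

Definition orthonormal_seq e := forall m n, hdot (e m) (e n) = (m == n)%:R.

Definition seq_span e : set H :=
  [set x | exists n (a : 'I_n -> R[i]), x = \sum_(i < n) a i *: e i].

Definition orthonormal_basis e :=
  orthonormal_seq e /\ closure (seq_span e) = setT.

End Operators.

Arguments separable_space {R} H.

Section Extensions.
Context {R : realType} {H K : hilbertType R}.

(* The inclusion of H in K is rendered by an isometric linear J : H -> K. *)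
Definition normal_extension (S : operator H) (J : {linear H -> K})
    (N : operator K) :=
  [/\ forall x y, hdot (J x) (J y) = hdot x y,
      normal_op N &
      forall x, dom S x -> dom N (J x) /\ N (J x) = J (S x)].

Definition tight (S : operator H) (J : {linear H -> K}) (N : operator K) :=
  dom (closure_op S) = J @^-1` dom (closure_op N).

Definition star_tight (S : operator H) (J : {linear H -> K}) (N : operator K) :=
  J @^-1` dom (adj_op N) = dom (adj_op S).

End Extensions.

Definition subnormal (R : realType) (H : hilbertType R) (S : operator H) :=
  densely_defined S /\
  exists (K : hilbertType R) (J : {linear H -> K}) (N : operator K),
    normal_extension S J N.

Definition qint (R : realType) (q : R) (n : nat) : R := \sum_(k < n) q ^+ k.

Section Conditions.
Context {R : realType} {H : hilbertType R}.
Implicit Types (q : R) (S : operator H) (D : set H).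

Definition Oq_dom q S D :=
  [/\ closable S, linear_subspace D, dense D,
      D `<=` dom (comp_op (adj_op S) (closure_op S))
             `&` dom (comp_op (closure_op S) (adj_op S)) &
      forall f, D f ->
        comp_op (adj_op S) (closure_op S) f
        - q%:C *: comp_op (closure_op S) (adj_op S) f = f].

Definition Oq_weak q S :=
  forall f g, (dom S `&` dom (adj_op S)) f -> (dom S `&` dom (adj_op S)) g ->
    hdot (S f) (S g) - q%:C * hdot (adj_op S f) (adj_op S g) = hdot f g.

(* In the conditions below, irreducibility, invariance and [Oq_weak] are imposed
   on the closure of S, as these notions do not transfer between a closable
   operator and its closure. *)

(* [core S (seq_span e)] excludes proper closed extensions of the q-creation
   operator, which also satisfy the relations on the e n. *)
Definition cond_i q S :=
  separable_space H /\
  exists e : nat -> H,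
    [/\ orthonormal_basis e,
        forall n, dom (closure_op S) (e n),
        forall n, closure_op S (e n) = (Num.sqrt (qint q n.+1))%:C *: e n.+1 &
        core S (seq_span e)].

Definition cond_ii q S :=
  [/\ irreducible_op (closure_op S),
      exists D : set H,
        [/\ Oq_dom q S D, invariant (closure_op S) D, invariant (adj_op S) D &
            core S D],
      subnormal S &
      exists (K : hilbertType R) (J : {linear H -> K}) (N : operator K),
        [/\ normal_extension S J N, tight S J N & star_tight S J N]].

Definition cond_iii q S :=
  irreducible_op (closure_op S) /\
  exists D : set H, [/\ Oq_dom q S D, core S D & core (adj_op S) D].

Definition cond_iv q S :=
  [/\ irreducible_op (closure_op S), Oq_weak q (closure_op S) &
      dom (closure_op S) = dom (adj_op S)].

Definition cond_v q S :=
  [/\ irreducible_op (closure_op S),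
      Oq_weak q (closure_op S),
      dense (dom (closure_op S) `&` dom (adj_op S)),
      ker_op (adj_op S) <> [set 0] &
      forall n f, ker_op (adj_op S) f ->
        dom (pow_op (closure_op S) n) f /\
        (dom (closure_op S) `&` dom (adj_op S)) (pow_op (closure_op S) n f)].

End Conditions.

(* Main.v *)
Require Import Defs.
From HB Require Import structures.
From mathcomp Require Import all_boot all_order all_algebra sesquilinear.
From mathcomp Require Import complex ring lra zify.
From mathcomp Require Import all_classical all_reals all_analysis.

(* (ii) => (iii) => (iv): the weak relation makes the graph norms of the closure T
   and of S^* equivalent on the domain D, so approximation in one of them is
   approximation in the other, and dom T = dom S^*.
   (iv) => (v): if ker S^* = 0 then T is onto, and a lower bound |T f|^2 >= a |f|^2
   passes to S^* and then, by the relation, improves to a + 1, which cannot go on.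
   (v) => (i): the orbit of a vacuum vector under T is orthogonal with
   S^* T^(n+1) f = [n+1] T^n f, and its closed span reduces T.
   (i) => (ii): the projection on a reducing subspace preserves the line ker S^*, hence
   irreducibility.  As H has an infinite orthonormal basis, it can itself play the
   role of the larger space K, once its basis is indexed by pairs.  For q = 1 the
   normal extension is a^* (x) 1 + 1 (x) b on two modes; for q > 1 it is a weighted
   shift built on a discrete measure with moments [n]_q!.  Every normal extension
   turns out to be tight, because T is the maximal weighted shift.  *)

Set Implicit Arguments.
Unset Strict Implicit.
Unset Printing Implicit Defensive.

Import Order.TTheory GRing.Theory Num.Theory.
Import numFieldNormedType.Exports.

Local Open Scope classical_set_scope.
Local Open Scope ring_scope.
Local Open Scope complex_scope.

Local Notation "''[' x , y ]" := (hdot x y).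

(** * Hilbert space geometry *)

Section Scalars.
Context {R : realType}.
Implicit Types (a b : R[i]) (r : R).

(** The main obstacle is the normal extension in (i) => (ii). Formal normality on a finite span is
    not enough, since a formally normal operator need not have a normal extension. The construction
    therefore starts from the largest weak domain ([maxop]), and normality amounts to approximating
    each of its vectors, in graph norm, by finite combinations. A normal extension of the shift with
    weights sqrt([n+1]_q) is multiplication by z for a rotation invariant planar measure, provided
    the law of |z|^2 has moments [n]_q!. For q > 1 such a law can be carried by the points q^(-k), k
    an integer; Fourier modes on the circles then turn multiplication by z into a shift indexed by
    pairs of integers. For q = 1 the law must be exp(-t) dt, which has no atoms; the two-mode
    operator replaces the integrals by algebra. On the side of the ladder, one exact identity does
    most of the work: T sends the partial sum of length n of x to the partial sum of length n + 1 of
    T x, with no truncation error. Reduction, the core property and tightness all come from it by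
    closedness. *)

Definition csq a : R := complex.Re a ^+ 2 + complex.Im a ^+ 2.

Lemma csqE a : (csq a)%:C = a * a^*%C.
Proof. by rewrite add_Re2_Im2 sqr_normc. Qed.

Lemma csq_ge0 a : 0 <= csq a.
Proof. by rewrite addr_ge0 // sqr_ge0. Qed.

Lemma csq_eq0 a : (csq a == 0) = (a == 0).
Proof. by rewrite -(inj_eq (@complexI R)) csqE mulf_eq0 conjc_eq0 orbb. Qed.

Lemma csq0 : csq 0 = 0.
Proof. by rewrite /csq /= expr0n /= addr0. Qed.

Lemma csqM a b : csq (a * b) = csq a * csq b.
Proof. by apply: complexI; rewrite rmorphM /= !csqE rmorphM /=; ring. Qed.

Lemma csqN a : csq (- a) = csq a.
Proof. by rewrite /csq !raddfN /= !sqrrN. Qed.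

Lemma csqJ a : csq a^*%C = csq a.
Proof. by case: a => x y; rewrite /csq /= sqrrN. Qed.

Lemma csqR r : csq r%:C = r ^+ 2.
Proof. by rewrite /csq /= expr0n /= addr0. Qed.

Lemma normC_csq a : `|a| = (Num.sqrt (csq a))%:C.
Proof. by rewrite normc_def. Qed.

Lemma csqD_le a b : csq (a + b) <= 2 * csq a + 2 * csq b.
Proof.
case: a => a1 a2; case: b => b1 b2; rewrite /csq /=.
have := sqr_ge0 (a1 - b1); have := sqr_ge0 (a2 - b2); rewrite !sqrrB !sqrrD; lra.
Qed.

End Scalars.

Section InnerProduct.
Context {R : realType} {H : hilbertType R}.
Implicit Types (x y z : H) (a b : R[i]).

Lemma hdotDl x y z : '[x + y, z] = '[x, z] + '[y, z].
Proof. exact: linearDl. Qed.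
Lemma hdotBl x y z : '[x - y, z] = '[x, z] - '[y, z].
Proof. exact: linearBl. Qed.
Lemma hdotDr x y z : '[x, y + z] = '[x, y] + '[x, z].
Proof. exact: linearDr. Qed.
Lemma hdotBr x y z : '[x, y - z] = '[x, y] - '[x, z].
Proof. exact: linearBr. Qed.
Lemma hdotZl a x y : '[a *: x, y] = a * '[x, y].
Proof. exact: linearZl_LR. Qed.
Lemma hdotZr a x y : '[x, a *: y] = a^*%C * '[x, y].
Proof. exact: linearZr_LR. Qed.
Lemma hdotC x y : '[x, y] = '[y, x]^*.
Proof. by rewrite hermC expr0 mul1r. Qed.
Lemma hdot0l x : '[0, x] = 0. Proof. exact: linear0l. Qed.
Lemma hdot0r x : '[x, 0] = 0. Proof. exact: linear0r. Qed.
Lemma hdotNl x y : '[- x, y] = - '[x, y]. Proof. exact: linearNl. Qed.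
Lemma hdotNr x y : '[x, - y] = - '[x, y]. Proof. exact: linearNr. Qed.

Lemma hdot_suml (I : Type) (s : seq I) (P : pred I) (f : I -> H) y :
  '[\sum_(i <- s | P i) f i, y] = \sum_(i <- s | P i) '[f i, y].
Proof. exact: linear_sumlz. Qed.
Lemma hdot_sumr (I : Type) (s : seq I) (P : pred I) (f : I -> H) y :
  '[y, \sum_(i <- s | P i) f i] = \sum_(i <- s | P i) '[y, f i].
Proof. exact: linear_sumr. Qed.

(** The norm of [H] takes values in [R[i]]; the squared norm is kept in [R], so that estimates are
    inequalities between reals without square roots. *)
Definition nsq x : R := complex.Re '[x, x].

Lemma nsqE x : (nsq x)%:C = '[x, x].
Proof. by rewrite /nsq RRe_real // ger0_real // -sqr_norm_hdot exprn_ge0. Qed.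

Lemma nsq_norm x : (nsq x)%:C = `|x| ^+ 2.
Proof. by rewrite nsqE sqr_norm_hdot. Qed.

Lemma nsq_ge0 x : 0 <= nsq x.
Proof. by rewrite -ler0c nsq_norm exprn_ge0. Qed.

Lemma norm_nsq x : `|x| = (Num.sqrt (nsq x))%:C.
Proof.
apply/eqP; rewrite -(@eqrXn2 _ 2) // ?normr_ge0 ?ler0c ?sqrtr_ge0 //.
by rewrite -nsq_norm -rmorphXn /= sqr_sqrtr // nsq_ge0.
Qed.

Lemma nsq_eq0 x : (nsq x == 0) = (x == 0).
Proof.
by rewrite -(inj_eq (@complexI R)) nsq_norm sqrf_eq0 normr_eq0.
Qed.

Lemma nsq0 : nsq 0 = 0. Proof. by rewrite /nsq hdot0l. Qed.

Lemma nsqZ a x : nsq (a *: x) = csq a * nsq x.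
Proof. by apply: complexI; rewrite rmorphM /= !nsqE csqE hdotZl hdotZr mulrA. Qed.

Lemma nsqN x : nsq (- x) = nsq x.
Proof. by rewrite /nsq hdotNl hdotNr opprK. Qed.

Lemma nsqBC x y : nsq (x - y) = nsq (y - x).
Proof. by rewrite -nsqN opprB. Qed.

Lemma nsqD x y : nsq (x + y) = nsq x + nsq y + 2 * complex.Re '[x, y].
Proof.
rewrite /nsq hdotDl !hdotDr (hdotC y x) !raddfD /=.
by case: '[x, y] => u v /=; ring.
Qed.

Lemma nsqB x y : nsq (x - y) = nsq x + nsq y - 2 * complex.Re '[x, y].
Proof. by rewrite nsqD nsqN hdotNr raddfN /= mulrN. Qed.

(** Stands in for the triangle inequality. The factor 2 is the price of working with squares, and
    explains the small fractions of the error used later. *)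
Lemma nsqD_le x y : nsq (x + y) <= 2 * nsq x + 2 * nsq y.
Proof. by have := nsq_ge0 (x - y); rewrite nsqB nsqD; lra. Qed.

Lemma nsqB_le x y z : nsq (x - z) <= 2 * nsq (x - y) + 2 * nsq (y - z).
Proof. by rewrite -(subrKA y) nsqD_le. Qed.

Lemma nsq_orth x y : '[x, y] = 0 -> nsq (x + y) = nsq x + nsq y.
Proof. by move=> xy; rewrite nsqD xy /= mulr0 addr0. Qed.

(** Removing the component along [y] gives Cauchy-Schwarz, and in [projection_ex] it measures the
    gain of a correction along a vector of the subspace. *)
Lemma nsq_sub_proj x y : y != 0 ->
  nsq (x - ('[x, y] / '[y, y]) *: y) = nsq x - csq '[x, y] / nsq y.
Proof.
move=> y0; have ny : nsq y != 0 by rewrite nsq_eq0.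
rewrite nsqB nsqZ hdotZr.
have -> : '[x, y] / '[y, y] = '[x, y] * ((nsq y)^-1)%:C.
  by rewrite -nsqE (fmorphV (real_complex R)).
case: '[x, y] => u v; rewrite /csq /=; field.
exact: ny.
Qed.

Lemma cauchy_schwarz x y : csq '[x, y] <= nsq x * nsq y.
Proof.
have [->|y0] := eqVneq y 0; first by rewrite hdot0r nsq0 mulr0 csq0.
have y_gt0 : 0 < nsq y by rewrite lt_def nsq_eq0 y0 nsq_ge0.
have := nsq_ge0 (x - ('[x, y] / '[y, y]) *: y).
by rewrite nsq_sub_proj // subr_ge0 ler_pdivrMr.
Qed.

Lemma hdot_eq0 x : (forall z, '[x, z] = 0) -> x = 0.
Proof. by move=> h; apply/eqP; rewrite -nsq_eq0 /nsq h. Qed.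

Lemma cvg_nsqP (u : nat -> H) x :
  u @ \oo --> x <->
  forall e : R, 0 < e -> \forall n \near \oo, nsq (u n - x) < e.
Proof.
split=> [/cvgrPdist_lt ux e e0|ux].
  have : (0 : R[i]) < (Num.sqrt e)%:C by rewrite ltcR sqrtr_gt0.
  move=> /ux; apply: filterS => n.
  by rewrite distrC norm_nsq ltcR ltr_sqrt.
apply/cvgrPdist_lt => e e0.
have [e' ee'] : exists e', e = e'%:C by exists (complex.Re e); rewrite RRe_real ?gtr0_real.
move: e0; rewrite ee' ltcR => e0.
have : 0 < e' ^+ 2 by rewrite exprn_gt0.
move=> /ux; apply: filterS => n.
rewrite distrC norm_nsq ltcR => h.
by rewrite -(ger0_norm (ltW e0)) -sqrtr_sqr ltr_sqrt ?exprn_gt0.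
Qed.

Lemma nsq_complete (u : nat -> H) :
  (forall e : R, 0 < e ->
     exists N, forall m n, (N <= m)%N -> (N <= n)%N -> nsq (u m - u n) < e) ->
  exists x, u @ \oo --> x.
Proof.
move=> cu.
have : cauchy (u @ \oo).
  apply/cauchyP => e e0.
  have [e' ee'] : exists e', e = e'%:C by exists (complex.Re e); rewrite RRe_real ?gtr0_real.
  move: e0; rewrite ee' ltcR => e0.
  have [N hN] := cu (e' ^+ 2) (exprn_gt0 _ e0).
  exists (u N); exists N => // n /= Nn.
  rewrite -ball_normE /ball_ /= norm_nsq ltcR.
  by rewrite -(ger0_norm (ltW e0)) -sqrtr_sqr ltr_sqrt ?exprn_gt0 // hN.
by move=> /cauchy_cvg ux; exists (lim (u @ \oo)).
Qed.

End InnerProduct.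

(** * Closures and limits in terms of squared norms *)

Section Topology.
Context {R : realType} {H : hilbertType R}.
Implicit Types (x y z : H) (a b : R[i]) (u v : nat -> H) (A : set H).

Lemma nbhs_nsqP x A :
  nbhs x A <-> exists2 e : R, 0 < e & forall z, nsq (z - x) < e -> A z.
Proof.
split=> [/nbhs_ballP [e /= e0 eA]|[e e0 eA]].
  have ee' : e = (complex.Re e)%:C by rewrite RRe_real ?gtr0_real.
  move: e0 eA; rewrite ee' ltcR; move: (complex.Re e) => {ee'} {}e e0 eA.
  exists (e ^+ 2); first by rewrite exprn_gt0.
  move=> z zx; apply: eA; rewrite -ball_normE /ball_ /= norm_nsq nsqBC ltcR.
  by rewrite -(ger0_norm (ltW e0)) -sqrtr_sqr ltr_sqrt ?exprn_gt0.
apply/nbhs_ballP; exists (Num.sqrt e)%:C; first by rewrite /= ltcR sqrtr_gt0.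
move=> z; rewrite -ball_normE /ball_ /= norm_nsq nsqBC ltcR ltr_sqrt //.
exact: eA.
Qed.

Lemma closure_nsqP A x :
  closure A x <-> forall e : R, 0 < e -> exists2 z, A z & nsq (z - x) < e.
Proof.
split=> [cA e e0|cA B /nbhs_nsqP [e /cA [z Az zx] eB]]; last by exists z; split=> //; exact: eB.
by have /cA[z []] : nbhs x [set z | nsq (z - x) < e]; [apply/nbhs_nsqP; exists e | exists z].
Qed.

Lemma closure2_nsqP (G : set (H * H)) x y :
  closure G (x, y) <->
  forall e : R, 0 < e -> exists z w, [/\ G (z, w), nsq (z - x) < e & nsq (w - y) < e].
Proof.
split=> [cG e e0|cG B [[B1 B2] [/= /nbhs_nsqP[e1 e10 eB1] /nbhs_nsqP[e2 e20 eB2]] B12]].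
  have /cG[[z w] [Gzw [/= zx wy]]] :
      nbhs (x, y) ([set z | nsq (z - x) < e] `*` [set z | nsq (z - y) < e]).
    by exists ([set z | nsq (z - x) < e], [set z | nsq (z - y) < e]) => //=;
      split; apply/nbhs_nsqP; exists e.
  by exists z, w.
have /cG[z [w [Gzw zx wy]]] : 0 < Num.min e1 e2 by rewrite lt_min e10.
exists (z, w); split=> //; apply: B12; split=> /=.
  by apply: eB1; rewrite (lt_le_trans zx) // ge_min lexx.
by apply: eB2; rewrite (lt_le_trans wy) // ge_min lexx orbT.
Qed.

Lemma invn_cvg0 (e : R) : 0 < e -> \forall n \near \oo, n.+1%:R^-1 < e.
Proof. by move=> e0; exact: (near_infty_natSinv_lt (PosNum e0)). Qed.

Lemma closure_seqP A x :
  closure A x <-> exists2 u, (forall n, A (u n)) & u @ \oo --> x.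
Proof.
split=> [/closure_nsqP cA|[u Au /cvg_nsqP ux]].
  have /choice[u hu] : forall n, exists z, A z /\ nsq (z - x) < n.+1%:R^-1.
    by move=> n; have [//|z Az zx] := cA n.+1%:R^-1; exists z.
  exists u; first by move=> n; have [] := hu n.
  apply/cvg_nsqP => e /invn_cvg0; apply: filterS => n.
  by apply: lt_trans; have [] := hu n.
apply/closure_nsqP => e /ux [N _ hN]; exists (u N) => //; exact: hN (leqnn N).
Qed.

Lemma closure2_seqP (G : set (H * H)) x y :
  closure G (x, y) <->
  exists u v, [/\ forall n, G (u n, v n), u @ \oo --> x & v @ \oo --> y].
Proof.
split=> [/closure2_nsqP cG|[u [v [Guv /cvg_nsqP ux /cvg_nsqP vy]]]].
  have /choice[u /choice[v hu]] : forall n, exists z w,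
      [/\ G (z, w), nsq (z - x) < n.+1%:R^-1 & nsq (w - y) < n.+1%:R^-1].
    by move=> n; apply: cG.
  exists u, v; split; first by move=> n; have [] := hu n.
    apply/cvg_nsqP => e /invn_cvg0; apply: filterS => n.
    by apply: lt_trans; have [] := hu n.
  apply/cvg_nsqP => e /invn_cvg0; apply: filterS => n.
  by apply: lt_trans; have [] := hu n.
apply/closure2_nsqP => e e0; have [N _ hN] := filterI (ux _ e0) (vy _ e0).
by have [] := hN N (leqnn N); exists (u N), (v N).
Qed.

Lemma cvg_csqP (s : nat -> R[i]^o) (a : R[i]^o) :
  s @ \oo --> a <->
  forall e : R, 0 < e -> \forall n \near \oo, csq (s n - a) < e.
Proof.
split=> [/cvgrPdist_lt ux e e0|ux].
  have : (0 : R[i]) < (Num.sqrt e)%:C by rewrite ltcR sqrtr_gt0.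
  move=> /ux; apply: filterS => n.
  by rewrite distrC normC_csq ltcR ltr_sqrt.
apply/cvgrPdist_lt => e e0.
have ee' : e = (complex.Re e)%:C by rewrite RRe_real ?gtr0_real.
move: e0; rewrite ee' ltcR; move: (complex.Re e) => {ee'} {}e e0.
have : 0 < e ^+ 2 by rewrite exprn_gt0.
move=> /ux; apply: filterS => n.
rewrite distrC normC_csq ltcR => h.
by rewrite -(ger0_norm (ltW e0)) -sqrtr_sqr ltr_sqrt ?exprn_gt0.
Qed.

Lemma cvg_hdotl u x y : u @ \oo --> x -> (fun n => '[u n, y] : R[i]^o) @ \oo --> ('[x, y] : R[i]^o).
Proof.
move=> /cvg_nsqP ux; apply/cvg_csqP => e e0.
have c0 : 0 < nsq y + 1 by rewrite ltr_wpDl ?nsq_ge0.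
have /ux : 0 < e / (nsq y + 1) by rewrite divr_gt0.
apply: filterS => n; rewrite ltr_pdivlMr // -hdotBl; apply: le_lt_trans.
rewrite (le_trans (cauchy_schwarz _ _)) // ler_wpM2l ?nsq_ge0 //; lra.
Qed.

Lemma cvg_conjc (s : nat -> R[i]^o) (a : R[i]^o) :
  s @ \oo --> a -> (fun n => (s n)^*%C : R[i]^o) @ \oo --> (a^*%C : R[i]^o).
Proof.
move=> /cvg_csqP sa; apply/cvg_csqP => e /sa; apply: filterS => n.
by rewrite -rmorphB /= csqJ.
Qed.

Lemma cvg_hdotr u x y : u @ \oo --> x -> (fun n => '[y, u n] : R[i]^o) @ \oo --> ('[y, x] : R[i]^o).
Proof.
move=> ux; rewrite hdotC; under eq_fun do rewrite hdotC.
exact/cvg_conjc/cvg_hdotl.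
Qed.

Lemma cvg_hdot u v x y : u @ \oo --> x -> v @ \oo --> y ->
  (fun n => '[u n, v n] : R[i]^o) @ \oo --> ('[x, y] : R[i]^o).
Proof.
move=> ux vy.
suff uv0 : (fun n => '[u n - x, v n - y] : R[i]^o) @ \oo --> (0 : R[i]^o).
  apply/cvg_csqP => e e0; have e10 : 0 < e / 10 by rewrite divr_gt0.
  move/cvg_csqP: uv0 => /(_ _ e10) h1.
  move/cvg_hdotl: ux => /(_ y)/cvg_csqP/(_ _ e10) h2.
  move/cvg_hdotr: vy => /(_ x)/cvg_csqP/(_ _ e10) h3.
  near=> n.
  have g1 : csq ('[u n - x, v n - y] - 0) < e / 10 by near: n.
  have g2 : csq ('[u n, y] - '[x, y]) < e / 10 by near: n.
  have g3 : csq ('[x, v n] - '[x, y]) < e / 10 by near: n.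
  have -> : '[u n, v n] - '[x, y] =
     ('[u n - x, v n - y] - 0) + (('[u n, y] - '[x, y]) + ('[x, v n] - '[x, y])).
    by rewrite !hdotBr !hdotBl; ring.
  apply: le_lt_trans (csqD_le _ _) _.
  have := csqD_le ('[u n, y] - '[x, y]) ('[x, v n] - '[x, y]).
  move: (csq _) (csq _) (csq _) (csq _) g1 g2 g3 => *; lra.
apply/cvg_csqP => e e0.
have e1 : 0 < Num.min e 1 by rewrite lt_min e0 ltr01.
move/cvg_nsqP: ux => /(_ _ e1) ux; move/cvg_nsqP: vy => /(_ _ e1) vy.
near=> n.
have : nsq (u n - x) < Num.min e 1 by near: n.
have : nsq (v n - y) < Num.min e 1 by near: n.
rewrite subr0 !lt_min => /andP[h1 h2] /andP[h3 h4].
apply: le_lt_trans (cauchy_schwarz _ _) _.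
have := nsq_ge0 (u n - x); have := nsq_ge0 (v n - y); nra.
Unshelve. all: by end_near. Qed.

Lemma cvg_Re (s : nat -> R[i]^o) (a : R[i]^o) :
  s @ \oo --> a -> (fun n => complex.Re (s n)) @ \oo --> complex.Re a.
Proof.
move=> /cvg_csqP sa; apply/cvgrPdist_lt => e e0.
have /sa : 0 < e ^+ 2 by rewrite exprn_gt0.
apply: filterS => n; rewrite /csq raddfB /= => h.
rewrite distrC -(ltr_pXn2r (n := 2)) ?nnegrE // ?(ltW e0) // real_normK ?num_real //.
by apply: le_lt_trans h; rewrite lerDl sqr_ge0.
Qed.

Lemma cvg_nsq u x : u @ \oo --> x -> (fun n => nsq (u n)) @ \oo --> nsq x.
Proof. by move=> ux; apply: cvg_Re; exact: cvg_hdot. Qed.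

Lemma eq_cvg_scal (s : nat -> R[i]^o) (a b : R[i]^o) :
  s @ \oo --> a -> s @ \oo --> b -> a = b.
Proof.
move=> /cvg_csqP sa /cvg_csqP sb; apply/eqP; rewrite -subr_eq0 -csq_eq0.
apply: contrapT => /negP ab0.
have e0 : 0 < csq (a - b) / 8 by rewrite divr_gt0 // lt_def ab0 csq_ge0.
near \oo => n.
have : csq (s n - a) < csq (a - b) / 8 by near: n; exact: sa.
have : csq (s n - b) < csq (a - b) / 8 by near: n; exact: sb.
have -> : a - b = - (s n - a) + (s n - b) by ring.
have := csqD_le (- (s n - a)) (s n - b); rewrite csqN.
have := csq_ge0 (- (s n - a) + (s n - b)); lra.
Unshelve. all: by end_near. Qed.

Lemma eq_cvg_hdot u x v y x' y' : u @ \oo --> x -> v @ \oo --> y ->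
  (forall n, '[u n, x'] = '[v n, y']) -> '[x, x'] = '[y, y'].
Proof.
move=> ux vy uv; apply: (eq_cvg_scal (cvg_hdotl (y := x') ux)).
by move/funext: uv => ->; exact: cvg_hdotl.
Qed.

Lemma cvg_nsq_cauchy u x : u @ \oo --> x ->
  forall e : R, 0 < e ->
     exists N, forall m n, (N <= m)%N -> (N <= n)%N -> nsq (u m - u n) < e.
Proof.
move=> /cvg_nsqP ux e e0; have e4 : 0 < e / 4 by rewrite divr_gt0.
have [N _ hN] := ux _ e4; exists N => m n Nm Nn.
apply: le_lt_trans (nsqB_le _ x _) _.
by have := hN _ Nm; have := hN _ Nn; rewrite /= (nsqBC (u n)); lra.
Qed.

Lemma cvg_uniq u x y : u @ \oo --> x -> u @ \oo --> y -> x = y.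
Proof. by move=> ux uy; apply: (@cvg_unique _ _ (u @ \oo)) => //; exact: norm_hausdorff. Qed.

(** Source of most limits of images: an identity of forms bounds one sequence by another, and
    typically a closed operator then identifies the limit. *)
Lemma cvg_dominated u v : (forall e : R, 0 < e ->
     exists N, forall m n, (N <= m)%N -> (N <= n)%N -> nsq (u m - u n) < e) ->
  forall c : R, (forall m n, nsq (v m - v n) <= c * nsq (u m - u n)) ->
  exists y, v @ \oo --> y.
Proof.
move=> cu c uv; apply: nsq_complete => e e0.
have c0 : 0 < `|c| + 1 by rewrite ltr_wpDl.
have [N hN] := cu _ (divr_gt0 e0 c0); exists N => m n Nm Nn.
apply: le_lt_trans (uv _ _) _.
have := hN _ _ Nm Nn; rewrite ltr_pdivlMr //; apply: le_lt_trans.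
by rewrite mulrC ler_wpM2l ?nsq_ge0 // (le_trans (ler_norm _)) // lerDl ler01.
Qed.

End Topology.

(** * Orthogonal projections and density *)

Section Projection.
Context {R : realType} {H : hilbertType R}.
Implicit Types (x y z : H) (a b : R[i]) (u v : nat -> H) (L D : set H).

Lemma cvg_lin u v x y a : u @ \oo --> x -> v @ \oo --> y ->
  (fun n => a *: u n + v n) @ \oo --> a *: x + y.
Proof.
move=> /cvg_nsqP ux /cvg_nsqP vy; apply/cvg_nsqP => e e0.
have c0 : 0 < csq a + 1 by rewrite ltr_wpDl ?csq_ge0.
have e1 : 0 < e / 4 / (csq a + 1) by rewrite !divr_gt0.
have e2 : 0 < e / 4 by rewrite divr_gt0.
near=> n.
have : nsq (u n - x) < e / 4 / (csq a + 1) by near: n; exact: ux.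
have : nsq (v n - y) < e / 4 by near: n; exact: vy.
have -> : a *: u n + v n - (a *: x + y) = a *: (u n - x) + (v n - y).
  by rewrite scalerBr opprD addrACA.
rewrite (ltr_pdivlMr _ _ c0) => h1 h2; apply: le_lt_trans (nsqD_le _ _) _.
by rewrite nsqZ; have := nsq_ge0 (u n - x); nra.
Unshelve. all: by end_near. Qed.

Lemma cvg_hsub u v x y : u @ \oo --> x -> v @ \oo --> y ->
  (fun n => u n - v n) @ \oo --> x - y.
Proof.
move=> ux vy.
have -> : (fun n => u n - v n) = (fun n => (-1) *: v n + u n).
  by apply/funext => n; rewrite scaleN1r addrC.
have -> : x - y = (-1) *: y + x by rewrite scaleN1r addrC.
exact: cvg_lin.
Qed.

Lemma linear_subspaceZ L a x : linear_subspace L -> L x -> L (a *: x).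
Proof. by move=> [L0 LD] Lx; rewrite -[a *: x]addr0; apply: LD. Qed.

Lemma linear_subspaceD L x y : linear_subspace L -> L x -> L y -> L (x + y).
Proof. by move=> [L0 LD] Lx Ly; rewrite -[x]scale1r; apply: LD. Qed.

Lemma linear_subspaceB L x y : linear_subspace L -> L x -> L y -> L (x - y).
Proof. by move=> [L0 LD] Lx Ly; rewrite addrC -[- y]scaleN1r; apply: LD. Qed.

Lemma linear_subspace_sum L (I : eqType) (s : seq I) (c : I -> R[i]) (f : I -> H) :
  linear_subspace L -> (forall i, i \in s -> L (f i)) ->
  L (\sum_(i <- s) c i *: f i).
Proof.
move=> Ls Lf; rewrite big_seq; elim/big_rec : _ => [|i x /Lf Li Lx]; first by case: Ls.
by case: Ls => _; apply.
Qed.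

Lemma linear_subspace_closure L : linear_subspace L -> linear_subspace (closure L).
Proof.
move=> [L0 LD]; split; first exact: subset_closure.
move=> a x y /closure_seqP[u Lu ux] /closure_seqP[v Lv vy].
by apply/closure_seqP; exists (fun n => a *: u n + v n);
  [move=> n; exact: LD | exact: cvg_lin].
Qed.

(** Centred at [x]: the subtracted term involves the midpoint of [y] and [z], whose distance to [x]
    is bounded below by the infimum. Minimising sequences are therefore Cauchy. *)
Lemma parallelogram x y z :
  nsq (y - z) = 2 * nsq (x - y) + 2 * nsq (x - z) - 4 * nsq (x - (2^-1)%:C *: (y + z)).
Proof.
rewrite !nsqB nsqZ csqR nsqD hdotZr hdotDr. rewrite conjc_real.
case: '[x, y] => a b; case: '[x, z] => c d; case: '[y, z] => ? ? /=; by field.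
Qed.

Lemma closed_seq L u x : closed L -> (forall n, L (u n)) -> u @ \oo --> x -> L x.
Proof. by move=> /closure_id Lc Lu ux; rewrite Lc; apply/closure_seqP; exists u. Qed.

Lemma projection_ex L x : linear_subspace L -> closed L ->
  exists y, L y /\ forall z, L z -> '[x - y, z] = 0.
Proof.
move=> Ls Lc; have [L0 LD] := Ls.
pose E := [set nsq (x - y) | y in L]; pose d := inf E.
have E0 : nonempty E by exists (nsq (x - 0)); exists 0.
have Elb : has_lbound E by exists 0 => _ [y _ <-]; exact: nsq_ge0.
have dP y : L y -> d <= nsq (x - y) by move=> Ly; apply: ge_inf => //; exists y.
have /choice[u hu] : forall n : nat, exists y, L y /\ nsq (x - y) < d + n.+1%:R^-1.
  move=> n; have [|_ [y Ly <-] yd] := @inf_adherent _ E n.+1%:R^-1 _ (conj E0 Elb) => //.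
  by exists y.
have Lu n : L (u n) by have [] := hu n.
have [e e0|y uy] := @nsq_complete _ _ u.
  have : 0 < e / 4 by rewrite divr_gt0.
  move=> /invn_cvg0 [N _ hN]; exists N => m n Nm Nn.
  rewrite (parallelogram x).
  have := dP _ (linear_subspaceZ (2^-1)%:C Ls (linear_subspaceD Ls (Lu m) (Lu n))).
  have := hN _ Nm; have := hN _ Nn; rewrite /=.
  have [_] := hu m; have [_] := hu n; move: (_^-1) (_^-1) => *; lra.
have Ly : L y by exact: closed_seq Lc Lu uy.
exists y; split=> // z Lz.
have [->|z0] := eqVneq z 0; first exact: hdot0r.
have nz : 0 < nsq z by rewrite lt_def nsq_eq0 z0 nsq_ge0.
have yd : nsq (x - y) <= d.
  apply/ler_addgt0Pr => e e0.
  have e4 : 0 < e / 2 by rewrite divr_gt0.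
  have xu : (fun n => x - u n) @ \oo --> x - y by apply: cvg_hsub => //; exact: cvg_cst.
  have /cvgrPdist_lt/(_ _ e4) hx := cvg_nsq xu.
  near \oo => n.
  have : `|nsq (x - y) - nsq (x - u n)| < e / 2 by near: n.
  have : n.+1%:R^-1 < e / 2 by near: n; exact: invn_cvg0.
  have [_] := hu n; rewrite ltr_norml; move: (_^-1) => ? h1 h2 /andP[h3 h4]; lra.
(* Correcting [y] along [z] stays in [L]; by minimality the resulting gain in squared distance has
   to vanish. *)
have := dP _ (LD ('[x - y, z] / '[z, z]) _ _ Lz Ly).
rewrite opprD addrA addrAC nsq_sub_proj // => h.
apply/eqP; rewrite -csq_eq0 eq_le csq_ge0 andbT.
have : csq '[x - y, z] / nsq z <= 0 by lra.
by rewrite ler_pdivrMr // mul0r.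
Unshelve. all: by end_near. Qed.

Lemma oprojP L x : linear_subspace L -> closed L ->
  L (oproj L x) /\ forall z, L z -> '[x - oproj L x, z] = 0.
Proof. move=> Ls Lc; exact: (xgetPex 0 (projection_ex x Ls Lc)). Qed.

Lemma oproj_eq L x y : linear_subspace L -> closed L -> L y ->
  (forall z, L z -> '[x - y, z] = 0) -> oproj L x = y.
Proof.
move=> Ls Lc Ly xy; have [Lp xp] := oprojP x Ls Lc.
apply/eqP; rewrite -subr_eq0 -nsq_eq0 /nsq.
have Lpy := linear_subspaceB Ls Lp Ly.
have e : oproj L x - y = (x - y) - (x - oproj L x) by rewrite opprB [RHS]addrC addrA subrK.
by rewrite {1}e hdotBl xy // xp // subr0.
Qed.

(** The difference between a vector and its projection on the closure is orthogonal to [D]. *)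
Lemma orth_total_closure D : linear_subspace D ->
  (forall z, (forall x, D x -> '[x, z] = 0) -> z = 0) -> closure D = setT.
Proof.
move=> Ds Dt; apply/seteqP; split=> // x _.
have [Lp xp] := oprojP x (linear_subspace_closure Ds) (@closed_closure _ D).
have /eqP : x - oproj (closure D) x = 0.
  by apply: Dt => y Dy; rewrite hdotC xp ?conjc0 //; exact: subset_closure.
by rewrite subr_eq0 => /eqP ->.
Qed.

Lemma denseE D : dense D <-> closure D = setT.
Proof.
split=> [Dd|Dc O [x Ox] oO].
  apply/seteqP; split=> // x _ B; rewrite nbhsE; case=> O [oO Ox] OB.
  have [|y [Oy Dy]] := Dd O _ oO; first by exists x.
  by exists y; split=> //; exact: OB.
have : closure D x by rewrite Dc.
move=> /(_ O)[|y [Dy Oy]]; first exact: open_nbhs_nbhs.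
by exists y.
Qed.

Lemma dense_orth D x y : dense D -> (forall z, D z -> '[z, x] = '[z, y]) -> x = y.
Proof.
move=> /denseE Dc xy; apply/eqP; rewrite -subr_eq0; apply/eqP.
apply: hdot_eq0 => z; rewrite hdotC.
have /closure_seqP[u Du uz] : closure D z by rewrite Dc.
suff -> : '[z, x - y] = 0 by rewrite conjc0.
apply/eqP; rewrite hdotBr subr_eq0; apply/eqP.
by apply: (eq_cvg_hdot uz uz) => n; exact: xy.
Qed.

End Projection.

(** * Orthonormal families, series and bases *)

Section Orthonormal.
Context {R : realType} {H : hilbertType R} {I : eqType}.
Variable g : I -> H.
Hypothesis og : forall i j, '[g i, g j] = (i == j)%:R.
Implicit Types (s : seq I) (c : I -> R[i]) (x y : H).

Lemma hdot_orthonormal_sum s c j : uniq s ->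
  '[\sum_(i <- s) c i *: g i, g j] = if j \in s then c j else 0.
Proof.
move=> us; rewrite hdot_suml; case: ifPn => [js|js].
  rewrite (bigD1_seq j) //= hdotZl og eqxx mulr1 big1 ?addr0 // => i ij.
  by rewrite hdotZl og (negbTE ij) mulr0.
rewrite big_seq big1 // => i iis; rewrite hdotZl og.
by case: eqP iis js => [-> ->|] //; rewrite mulr0.
Qed.

Lemma nsq_orthonormal_sum s c : uniq s ->
  nsq (\sum_(i <- s) c i *: g i) = \sum_(i <- s) csq (c i).
Proof.
move=> us; apply: complexI; rewrite nsqE rmorph_sum hdot_sumr /=.
rewrite big_seq [RHS]big_seq; apply: eq_bigr => j js.
by rewrite hdotZr hdot_orthonormal_sum // js csqE mulrC.
Qed.

Lemma orthonormal_sum_orth s x y : uniq s ->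
  '[x - \sum_(i <- s) '[x, g i] *: g i, \sum_(i <- s) '[y, g i] *: g i] = 0.
Proof.
move=> us; rewrite hdot_sumr big_seq big1 // => j js.
by rewrite hdotZr hdotBl hdot_orthonormal_sum // js subrr mulr0.
Qed.

Lemma bessel s x : uniq s -> \sum_(i <- s) csq '[x, g i] <= nsq x.
Proof.
move=> us; have := nsq_orth (orthonormal_sum_orth x x us).
rewrite subrK nsq_orthonormal_sum // => ->.
by rewrite lerDr nsq_ge0.
Qed.

End Orthonormal.

Section OrthonormalSeq.
Context {R : realType} {H : hilbertType R}.
Implicit Types (e : nat -> H) (c : nat -> R[i]) (x y : H).

Lemma cvgn_cauchy (a : nat -> R) (l : R) : a @ \oo --> l -> forall e : R, 0 < e ->
  exists N, forall m n, (N <= m)%N -> (N <= n)%N -> `|a m - a n| < e.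
Proof.
move=> /cvgrPdist_lt al e e0; have /al [N _ hN] : 0 < e / 2 by rewrite divr_gt0.
exists N => m n Nm Nn; rewrite -(subrKA l).
apply: le_lt_trans (ler_normD _ _) _.
by have := hN _ Nm; have := hN _ Nn; rewrite /= (distrC (a m)); lra.
Qed.

Lemma riesz_fischer e c (M : R) : orthonormal_seq e ->
  (forall n, \sum_(0 <= i < n) csq (c i) <= M) ->
  exists2 y, (fun n => \sum_(0 <= i < n) c i *: e i) @ \oo --> y &
    forall j, '[y, e j] = c j.
Proof.
move=> oe cM; pose a n := \sum_(0 <= i < n) csq (c i).
have aS m n : (m <= n)%N -> a n = a m + \sum_(m <= i < n) csq (c i).
  by move=> mn; rewrite /a (big_cat_nat (n := m)).
have nda : nondecreasing_seq a.
  by move=> m n mn; rewrite (aS m n) // lerDl sumr_ge0 // => i _; exact: csq_ge0.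
have ac : cvgn a.
  by apply: nondecreasing_is_cvgn => //; exists M => _ [n _ <-]; exact: cM.
have h m n : (m <= n)%N -> nsq (\sum_(0 <= i < n) c i *: e i -
    \sum_(0 <= i < m) c i *: e i) = a n - a m.
  move=> mn; rewrite (big_cat_nat (n := m)) //= addrAC subrr add0r.
  by rewrite (nsq_orthonormal_sum oe) ?iota_uniq // (aS m n) // addrAC subrr add0r.
have [ep ep0|y Sy] := @nsq_complete _ _ (fun n => \sum_(0 <= i < n) c i *: e i).
  have [N hN] := cvgn_cauchy ac ep0; exists N => m n Nm Nn.
  have [mn|/ltnW nm] := leqP m n.
    by rewrite nsqBC h // (le_lt_trans (ler_norm _)) // hN.
  by rewrite h // (le_lt_trans (ler_norm _)) // hN.
exists y => // j.
have cj : (fun n => c j *: e j) @ \oo --> c j *: e j by exact: cvg_cst.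
have -> : c j = '[c j *: e j, e j] by rewrite hdotZl oe eqxx mulr1.
(* The shift by [j.+1] puts index [j] into every partial sum, so the [j]-th coefficient is constant
   along the sequence. *)
have Sy' : (fun n => \sum_(0 <= i < n + j.+1) c i *: e i) @ \oo --> y.
  by rewrite (cvg_shiftn j.+1 (fun n => \sum_(0 <= i < n) c i *: e i)).
apply: (eq_cvg_hdot Sy' cj) => n.
rewrite (hdot_orthonormal_sum oe) ?iota_uniq // mem_index_iota /= addnS ltnS leq_addl.
by rewrite hdotZl oe eqxx mulr1.
Qed.

Lemma seq_spanP e x :
  seq_span e x <-> exists n c, x = \sum_(0 <= i < n) c i *: e i.
Proof.
split=> [[n [a ->]]|[n [c ->]]]; last by exists n, (fun i => c i); rewrite big_mkord.
exists n, (fun i => if insub i is Some j then a j else 0).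
by rewrite big_mkord; apply: eq_bigr => i _; rewrite valK.
Qed.

Lemma seq_spanW e n c : seq_span e (\sum_(0 <= i < n) c i *: e i).
Proof. by apply/seq_spanP; exists n, c. Qed.

Lemma seq_span_basis e n : seq_span e (e n).
Proof.
apply/seq_spanP; exists n.+1, (fun i => (i == n)%:R).
rewrite big_nat_recr //= eqxx scale1r big_nat big1 ?add0r // => i /andP[_].
by rewrite ltn_neqAle => /andP[/negbTE -> _]; rewrite scale0r.
Qed.

Lemma sum_extend e c n m : (n <= m)%N ->
  \sum_(0 <= i < n) c i *: e i =
  \sum_(0 <= i < m) (if (i < n)%N then c i else 0) *: e i.
Proof.
move=> nm; rewrite [RHS](big_cat_nat (n := n)) //=.
have -> : \sum_(n <= i < m) (if (i < n)%N then c i else 0) *: e i = 0.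
  by rewrite big_nat big1 // => i /andP[ni _]; rewrite ltnNge ni scale0r.
by rewrite addr0 big_nat [RHS]big_nat; apply: eq_bigr => i /andP[_ ->].
Qed.

Lemma linear_seq_span e : linear_subspace (seq_span e).
Proof.
split; first by apply/seq_spanP; exists 0%N, (fun=> 0); rewrite big_nil.
move=> a x y /seq_spanP[n [c ->]] /seq_spanP[m [d ->]]; apply/seq_spanP.
exists (maxn n m); rewrite (sum_extend e c (leq_maxl n m)) (sum_extend e d (leq_maxr n m)).
rewrite scaler_sumr -big_split /=.
exists (fun i => a * (if (i < n)%N then c i else 0) + (if (i < m)%N then d i else 0)).
by apply: eq_bigr => i _; rewrite scalerDl scalerA.
Qed.

Lemma seq_span_sub e (L : set H) : linear_subspace L -> (forall n, L (e n)) ->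
  seq_span e `<=` L.
Proof.
by move=> Ls Le _ /seq_spanP[n [c ->]]; apply: linear_subspace_sum.
Qed.

Definition psum e x n := \sum_(0 <= i < n) '[x, e i] *: e i.

Lemma psum_in_span e x n : seq_span e (psum e x n).
Proof. exact: seq_spanW. Qed.

(** Among the combinations of the first m vectors the partial sum is the closest to [x], hence at
    least as good as any given approximant from the span. *)
Lemma psum_closure e x : orthonormal_seq e -> closure (seq_span e) x ->
  psum e x @ \oo --> x.
Proof.
move=> oe /closure_nsqP cx; apply/cvg_nsqP => ep /cx [_ /seq_spanP [n [c ->]] xep].
exists n => // m /= nm; apply: le_lt_trans xep.
rewrite nsqBC [leRHS]nsqBC (sum_extend e c nm).
set y := (\sum_(0 <= i < m) _).
have yE : y = psum e y m.
  rewrite {1}/y /psum big_nat [RHS]big_nat; apply: eq_bigr => i im.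
  by rewrite /y (hdot_orthonormal_sum oe) ?iota_uniq // mem_index_iota im.
have -> : x - y = (x - psum e x m) + psum e (x - y) m.
  rewrite {1}yE -addrA; congr (_ + _); rewrite -sumrN -sumrN -big_split /=.
  by apply: eq_bigr => i _; rewrite hdotBl -scaleNr -scaleNr -scalerDl addKr.
rewrite [leRHS]nsq_orth ?lerDl ?nsq_ge0 //.
by rewrite /psum (orthonormal_sum_orth oe) ?iota_uniq.
Qed.

Lemma psum_cvg e x : orthonormal_basis e -> psum e x @ \oo --> x.
Proof. by move=> [oe ce]; apply: psum_closure => //; rewrite ce. Qed.

Lemma parseval e x : orthonormal_basis e ->
  (fun n => \sum_(0 <= i < n) csq '[x, e i]) @ \oo --> nsq x.
Proof.
move=> be; have := cvg_nsq (psum_cvg (x := x) be).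
have [oe _] := be; suff -> : (fun n => nsq (psum e x n)) =
  (fun n => \sum_(0 <= i < n) csq '[x, e i]) by [].
by apply/funext => n; rewrite (nsq_orthonormal_sum oe) ?iota_uniq.
Qed.

Lemma basis_total e x : orthonormal_basis e -> (forall n, '[x, e n] = 0) -> x = 0.
Proof.
move=> be x0; apply: (cvg_uniq (psum_cvg (x := x) be)).
suff -> : psum e x = (fun=> 0) by exact: cvg_cst.
by apply/funext => n; rewrite /psum big1 // => i _; rewrite x0 scale0r.
Qed.

Lemma basis_eq e x y : orthonormal_basis e ->
  (forall n, '[x, e n] = '[y, e n]) -> x = y.
Proof.
move=> be xy; apply/eqP; rewrite -subr_eq0; apply/eqP/(basis_total be) => n.
by rewrite hdotBl xy subrr.
Qed.

Lemma total_basis e : orthonormal_seq e ->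
  (forall x, (forall n, '[x, e n] = 0) -> x = 0) -> orthonormal_basis e.
Proof.
move=> oe te; split=> //; apply: orth_total_closure; first exact: linear_seq_span.
move=> z h; apply: te => n; rewrite hdotC h ?conjc0 //; exact: seq_span_basis.
Qed.

Lemma basis_perm e (s t : nat -> nat) : cancel s t -> cancel t s ->
  orthonormal_basis e -> orthonormal_basis (e \o s).
Proof.
move=> st ts be; have [oe _] := be; apply: total_basis.
  by move=> m n; rewrite /= oe (can_eq st).
by move=> x h; apply: (basis_total be) => n; rewrite -(ts n); exact: h.
Qed.

End OrthonormalSeq.

(** * Unbounded operators *)

Section OperatorTheory.
Context {R : realType} {H : hilbertType R}.
Implicit Types (x y z : H) (u v : nat -> H) (A S : operator H) (D : set H).

Definition closed_op A := forall u x y, (forall n, dom A (u n)) ->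
  u @ \oo --> x -> (fun n => A (u n)) @ \oo --> y -> dom A x /\ A x = y.

Lemma linear_operatorB A x y : linear_operator A -> dom A x -> dom A y ->
  dom A (x - y) /\ A (x - y) = A x - A y.
Proof.
move=> [[A0 Ad] Al] Ax Ay; have -> : x - y = (-1) *: y + x by rewrite scaleN1r addrC.
split; first exact: Ad.
by rewrite Al // scaleN1r addrC.
Qed.

Lemma linear_operator0 A : linear_operator A -> A 0 = 0.
Proof.
by move=> Al; have [[A0 _] _] := Al; have [_] := linear_operatorB Al A0 A0; rewrite !subrr.
Qed.

Lemma linear_operatorZ A a x : linear_operator A -> dom A x ->
  dom A (a *: x) /\ A (a *: x) = a *: A x.
Proof.
move=> Al Ax; have [Ad AL] := Al; split; first exact: linear_subspaceZ.
by rewrite -[a *: x]addr0 AL ?linear_operator0 ?addr0 //; case: Ad.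
Qed.

Lemma linear_operator_sum A (I : eqType) (s : seq I) (c : I -> R[i]) (f : I -> H) :
  linear_operator A -> (forall i, dom A (f i)) ->
  dom A (\sum_(i <- s) c i *: f i) /\
  A (\sum_(i <- s) c i *: f i) = \sum_(i <- s) c i *: A (f i).
Proof.
move=> Al Af; have [[A0 Ad] AL] := Al.
elim: s => [|i s [IH1 IH2]]; first by rewrite !big_nil linear_operator0.
by rewrite !big_cons AL ?IH2 //; split=> //; exact: Ad.
Qed.

Lemma closure_op_limit A x : dom (closure_op A) x ->
  closure (graph A) (x, closure_op A x).
Proof. by move=> h; exact: (xgetPex 0 h). Qed.

Lemma closure_opE A x y : closable A -> closure (graph A) (x, y) ->
  dom (closure_op A) x /\ closure_op A x = y.
Proof.
move=> cA xy; have dx : dom (closure_op A) x by exists y.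
by split=> //; apply: cA xy; exact: closure_op_limit.
Qed.

Lemma closure_op_seq A x : dom (closure_op A) x ->
  exists u, [/\ forall n, dom A (u n), u @ \oo --> x &
    (fun n => A (u n)) @ \oo --> closure_op A x].
Proof.
move=> /closure_op_limit/closure2_seqP[u [v [uv ux vy]]].
exists u; split=> //; first by move=> n; have [] := uv n.
by suff -> : (fun n => A (u n)) = v by []; apply/funext => n; have [_ /= ->] := uv n.
Qed.

Lemma closed_op_closure A x y : closed_op A -> closure (graph A) (x, y) ->
  dom A x /\ A x = y.
Proof.
move=> cA /closure2_seqP[u [v [uv ux vy]]].
apply: (cA u) => //; first by move=> n; have [] := uv n.
by suff -> : (fun n => A (u n)) = v by []; apply/funext => n; have [_ /= ->] := uv n.
Qed.

Lemma closed_op_closable A : closed_op A -> closable A.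
Proof.
move=> cA x y z xy xz; have [_ <-] := closed_op_closure cA xy.
by have [_ <-] := closed_op_closure cA xz.
Qed.

Lemma graph_closure A x : dom A x -> closure (graph A) (x, A x).
Proof. by move=> Ax; apply: subset_closure. Qed.

Lemma closed_op_dom_closure A : closed_op A -> dom (closure_op A) = dom A.
Proof.
move=> cA; apply/seteqP; split=> x; first by move=> [y /(closed_op_closure cA)[]].
by move=> Ax; exists (A x); exact: graph_closure.
Qed.

Lemma closed_op_closureE A x : closed_op A -> dom A x -> closure_op A x = A x.
Proof.
move=> cA Ax.
by have [] := closure_opE (closed_op_closable cA) (graph_closure Ax).
Qed.

Lemma closure_op_extends A x : closable A -> dom A x ->
  dom (closure_op A) x /\ closure_op A x = A x.
Proof. by move=> cA Ax; apply: closure_opE => //; exact: graph_closure. Qed.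

Lemma closure_op_closed A : closable A -> closed_op (closure_op A).
Proof.
move=> cA u x y Au ux vy; apply: closure_opE => //.
apply: closed_closure; apply/closure2_seqP.
by exists u, (fun n => closure_op A (u n)); split=> // n; exact: closure_op_limit.
Qed.

Lemma closure_op_linear A : linear_operator A -> closable A ->
  linear_operator (closure_op A).
Proof.
move=> [[A0 Ad] Al] cA.
have lin (a : R[i]) x y : dom (closure_op A) x -> dom (closure_op A) y ->
    dom (closure_op A) (a *: x + y) /\
    closure_op A (a *: x + y) = a *: closure_op A x + closure_op A y.
  move=> /closure_op_seq[u [Au ux uAx]] /closure_op_seq[v [Av vy vAy]].
  apply: closure_opE => //; apply/closure2_seqP.
  exists (fun n => a *: u n + v n), (fun n => a *: A (u n) + A (v n)).
  split; [|exact: cvg_lin|exact: cvg_lin].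
  by move=> n; split=> /=; [exact: Ad | rewrite Al].
split; last by move=> a x y dx dy; have [] := lin a x y dx dy.
split; first by have [] := closure_op_extends cA A0.
by move=> a x y dx dy; have [] := lin a x y dx dy.
Qed.

Lemma adj_opE A y z : densely_defined A -> (forall x, dom A x -> '[A x, y] = '[x, z]) ->
  dom (adj_op A) y /\ adj_op A y = z.
Proof.
move=> dA h; have dy : dom (adj_op A) y by exists z.
split=> //; apply: (dense_orth dA) => x Ax.
by rewrite -h //; rewrite (xgetPex 0 dy).
Qed.

Lemma adj_opP A x y : dom A x -> dom (adj_op A) y -> '[A x, y] = '[x, adj_op A y].
Proof. by move=> Ax dy; exact: (xgetPex 0 dy _ Ax). Qed.

Lemma adj_op_closed A : densely_defined A -> closed_op (adj_op A).
Proof.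
move=> dA u x y Au ux vy; apply: adj_opE => // z Az.
rewrite hdotC (hdotC z); congr (_^*)%C.
by apply: (eq_cvg_hdot ux vy) => n; rewrite hdotC adj_opP // -hdotC.
Qed.

Lemma adj_op_linear A : densely_defined A -> linear_operator (adj_op A).
Proof.
move=> dA.
have lin (a : R[i]) x y : dom (adj_op A) x -> dom (adj_op A) y ->
    dom (adj_op A) (a *: x + y) /\ adj_op A (a *: x + y) = a *: adj_op A x + adj_op A y.
  move=> dx dy; apply: adj_opE => // z Az.
  by rewrite !hdotDr !hdotZr !adj_opP.
split; last by move=> a x y dx dy; have [] := lin a x y dx dy.
split; last by move=> a x y dx dy; have [] := lin a x y dx dy.
by have [] := @adj_opE A 0 0 dA _ => // x _; rewrite !hdot0r.
Qed.

Lemma closure_op_dense A : densely_defined A -> closable A ->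
  densely_defined (closure_op A).
Proof.
move=> dA cA O O0 oO; have [x [Ox Ax]] := dA O O0 oO; exists x; split=> //.
by have [] := closure_op_extends cA Ax.
Qed.

(** More than [op_eq]: [adj_op] depends on its argument only through the adjoint relation, which
    passes to graph limits. The two records thus agree, junk values included. *)
Lemma adj_closure_op A : closable A -> adj_op (closure_op A) = adj_op A.
Proof.
move=> cA.
pose mk (P : H -> H -> Prop) : operator H :=
  Operator [set y | exists z, P y z] (fun y => xget 0 [set z | P y z]).
pose isadj (B : operator H) y z := forall x, dom B x -> '[B x, y] = '[x, z].
suff h : isadj (closure_op A) = isadj A by exact: (congr1 mk h).
apply/funext => y; apply/funext => z; apply/propext; split=> h x Ax.
  by have [dx <-] := closure_op_extends cA Ax; exact: h.
have [u [Au ux uAx]] := closure_op_seq Ax.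
by apply: (eq_cvg_hdot uAx ux) => n; exact: h.
Qed.

(** Replaces an equality of closures by approximation in graph norm from [D], the form in which
    cores are both established and used. *)
Lemma coreP A D : closable A -> core A D <->
  [/\ linear_subspace D, D `<=` dom (closure_op A) &
    forall x, dom (closure_op A) x -> exists u,
      [/\ forall n, D (u n), u @ \oo --> x &
          (fun n => closure_op A (u n)) @ \oo --> closure_op A x]].
Proof.
move=> cA; set T := closure_op A; have cT : closed_op T by exact: closure_op_closed.
have gD : closure (graph (restrict_op T D)) `<=` closure (graph T).
  by apply: closure_subset => -[x y] [/= [Tx _] ->].
split=> [[Ds DT [[_ _] [TD _]]]|[Ds DT h]].
  split=> // x Tx; have /closure_op_seq[u [Du ux uy]] := TD _ Tx.
  exists u; split=> //; first by move=> n; have [] := Du n.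
  have : dom (closure_op (restrict_op T D)) x by exact: TD.
  move=> /closure_op_limit/gD/(closed_op_closure cT)[_ ->].
  exact: uy.
have cTD : closable (restrict_op T D).
  by move=> x y z /gD xy /gD xz; exact: (closed_op_closable cT xy xz).
have e x : dom T x -> dom (closure_op (restrict_op T D)) x /\
    closure_op (restrict_op T D) x = T x.
  move=> /h[u [Du ux uTx]]; apply: closure_opE => //; apply/closure2_seqP.
  exists u, (fun n => T (u n)); split=> // n.
  by split=> //; exact: (conj (DT _ (Du n)) (Du n)).
have e' x : dom (closure_op (restrict_op T D)) x -> dom T x /\
    T x = closure_op (restrict_op T D) x.
  by move=> /closure_op_limit/gD/(closed_op_closure cT).
split=> //; split; split=> x Tx.
- exact: (e' x Tx).1.
- by rewrite (e' x Tx).2.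
- exact: (e x Tx).1.
- by rewrite (e x Tx).2.
Qed.

(** The adjoint is closed, and equality of norms transfers convergence between the images under [A]
    and those under its adjoint. *)
Lemma normal_op_closed A : normal_op A -> closed_op A.
Proof.
move=> [Al dA dAA nA] u x y Au ux vy.
have lA' := adj_op_linear dA.
have Au' n : dom (adj_op A) (u n) by rewrite -dAA.
have nsqA z : dom A z -> nsq (adj_op A z) = nsq (A z).
  by move=> Az; apply: complexI; rewrite !nsq_norm nA.
have [w uw] : exists w : H, (fun n => adj_op A (u n)) @ \oo --> w.
  apply: (@cvg_dominated _ _ _ _ (cvg_nsq_cauchy vy) 1) => m n; rewrite mul1r.
  have [d1 <-] := linear_operatorB lA' (Au' m) (Au' n).
  by have [d2 <-] := linear_operatorB Al (Au m) (Au n); rewrite nsqA.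
have [dx Aw] := adj_op_closed dA Au' ux uw.
have Ax : dom A x by rewrite dAA.
split=> //; apply: (cvg_uniq (u := fun n => A (u n))) => //.
apply/cvg_nsqP => e e0; move/cvg_nsqP: uw => /(_ _ e0); apply: filterS => n.
have [d1 <-] := linear_operatorB Al (Au n) Ax.
rewrite -nsqA //; have [_ ->] := linear_operatorB lA' (Au' n) dx.
by rewrite Aw.
Qed.

End OperatorTheory.

Section ScalarLimits.
Context {R : realType}.

Lemma cvg_scal_lin (s t : nat -> R[i]^o) (a b : R[i]^o) (c : R[i]) :
  s @ \oo --> a -> t @ \oo --> b ->
  (fun n => c * s n + t n : R[i]^o) @ \oo --> (c * a + b : R[i]^o).
Proof.
move=> /cvg_csqP ux /cvg_csqP vy; apply/cvg_csqP => e e0.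
have c0 : 0 < csq c + 1 by rewrite ltr_wpDl ?csq_ge0.
have e1 : 0 < e / 4 / (csq c + 1) by rewrite !divr_gt0.
have e2 : 0 < e / 4 by rewrite divr_gt0.
near=> n.
have : csq (s n - a) < e / 4 / (csq c + 1) by near: n; exact: ux.
have : csq (t n - b) < e / 4 by near: n; exact: vy.
have -> : c * s n + t n - (c * a + b) = c * (s n - a) + (t n - b) by ring.
rewrite (ltr_pdivlMr _ _ c0) => h1 h2; apply: le_lt_trans (csqD_le _ _) _.
by rewrite csqM; have := csq_ge0 (s n - a); nra.
Unshelve. all: by end_near. Qed.

End ScalarLimits.

Section QInt.
Context {R : realType}.
Variable q : R.
Hypothesis hq : 1 <= q.

Lemma qintS n : qint q n.+1 = 1 + q * qint q n.
Proof.
rewrite /qint big_ord_recl expr0 mulr_sumr; congr (_ + _).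
by apply: eq_bigr => i _; rewrite -exprS.
Qed.

Lemma qint0 : qint q 0 = 0. Proof. by rewrite /qint big_ord0. Qed.

Lemma qint_ge0 n : 0 <= qint q n.
Proof. by apply: sumr_ge0 => i _; rewrite exprn_ge0 // (le_trans ler01). Qed.

Lemma qintS_gt0 n : 0 < qint q n.+1.
Proof. by rewrite qintS ltr_pwDl // mulr_ge0 ?qint_ge0 // (le_trans ler01). Qed.

End QInt.

Lemma dense_nonzero {R : realType} {H : hilbertType R} (D : set H) :
  (exists x : H, x != 0) -> dense D -> exists2 x, D x & x != 0.
Proof.
move=> [x x0] Dd; apply: contrapT => h; case/eqP: x0; apply: (dense_orth Dd) => z Dz.
have [->|z0] := eqVneq z 0; first by rewrite !hdot0l.
by case: h; exists z.
Qed.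

Section Separability.
Context {R : realType} {H : hilbertType R}.

Lemma rat_approx (a : R[i]) (ep : R) : 0 < ep ->
  exists t : rat * rat, csq (a - Complex (ratr t.1) (ratr t.2)) < ep.
Proof.
move=> ep0; case: a => u v.
have ap (w : R) : exists t : rat, (w - ratr t) ^+ 2 < ep / 2.
  have s0 : 0 < Num.sqrt (ep / 2) by rewrite sqrtr_gt0 divr_gt0.
  have [|t] := @rat_in_itvoo _ (w - Num.sqrt (ep / 2)) w; first by lra.
  rewrite in_itv /= => /andP[h1 h2]; exists t.
  rewrite -[ltRHS]sqr_sqrtr ?divr_ge0 ?(ltW ep0) // ltr_pXn2r ?nnegrE //; lra.
have [t1 h1] := ap u; have [t2 h2] := ap v.
by exists (t1, t2); rewrite /csq /=; move: h1 h2; move: (_ ^+ 2) (_ ^+ 2) => *; lra.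
Qed.

Lemma basis_separable (e : nat -> H) : orthonormal_basis e -> separable_space H.
Proof.
move=> be; have [oe _] := be.
pose F (t : seq (rat * rat)) : H := \sum_(0 <= i < size t)
  Complex (ratr (nth (0, 0) t i).1) (ratr (nth (0, 0) t i).2) *: e i.
exists (range F).
  have /countable_injP[g gi] := countableP [set: seq (rat * rat)].
  apply: sub_countable (card_image_le F setT) _.
  exact: countableP.
apply/denseE/seteqP; split=> // x _; apply/closure_nsqP => ep ep0.
have /cvg_nsqP/(_ _ (divr_gt0 ep0 (ltr0n _ 4))) [N _ hN] := psum_cvg (x := x) be.
have := hN N (leqnn N); rewrite /= => xN.
(* An equal share of the error for each of the [N] coefficients; [N.+1] keeps the division
   meaningful when [N] is 0. *)
have epN : 0 < ep / 4 / N.+1%:R by rewrite !divr_gt0.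
have /choice[c hc] := fun i => rat_approx '[x, e i] epN.
exists (F (mkseq c N)); first by exists (mkseq c N).
apply: le_lt_trans (nsqB_le _ (psum e x N) _) _.
suff : nsq (F (mkseq c N) - psum e x N) <= ep / 4 by lra.
have -> : F (mkseq c N) - psum e x N = \sum_(0 <= i < N)
    - ('[x, e i] - Complex (ratr (c i).1) (ratr (c i).2)) *: e i.
  rewrite /F /psum size_mkseq -sumrN -big_split big_nat [RHS]big_nat /=.
  apply: eq_bigr => i /= iN.
  by rewrite nth_mkseq // -scaleNr -scalerDl opprB.
rewrite (nsq_orthonormal_sum oe) ?iota_uniq //.
have : \sum_(0 <= i < N) csq (- ('[x, e i] - Complex (ratr (c i).1) (ratr (c i).2)))
    <= \sum_(0 <= i < N) (ep / 4 / N.+1%:R).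
  by apply: ler_sum => i _; rewrite csqN ltW.
move=> h; apply: le_trans h _; rewrite sumr_const_nat subn0 -(mulr_natr _ N).
rewrite -mulrA ler_piMr ?divr_ge0 ?(ltW ep0) //.
by rewrite mulrC ler_pdivrMr // mul1r ler_nat.
Qed.

End Separability.

(** * Normal operators extending the creation operator *)

Section MaximalOperator.
Context {R : realType} {H : hilbertType R} {I : eqType}.
Variable b : I -> H.
Hypothesis b_total : forall x, (forall i, '[x, b i] = 0) -> x = 0.
Implicit Types (a : I -> H) (x y z : H).

(* The adjoint of the operator sending each [b i] to [a i]. *)
Definition maxop a : operator H :=
  Operator [set x | exists y, forall i, '[y, b i] = '[x, a i]]
           (fun x => xget 0 [set y | forall i, '[y, b i] = '[x, a i]]).

(** The pair lies in the closure of the graph of the minimal operator, which sends [b i] to [a i] on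
    finite combinations. *)
Definition finite_approx a x y := exists (s : nat -> seq I) (c : nat -> I -> R[i]),
  (fun n => \sum_(i <- s n) c n i *: b i) @ \oo --> x /\
  (fun n => \sum_(i <- s n) c n i *: a i) @ \oo --> y.

Lemma maxopE a x y : (forall i, '[y, b i] = '[x, a i]) ->
  dom (maxop a) x /\ maxop a x = y.
Proof.
move=> h; have dx : dom (maxop a) x by exists y.
split=> //; apply/eqP; rewrite -subr_eq0; apply/eqP; apply: b_total => i.
by rewrite hdotBl h; have /= -> := xgetPex 0 dx; rewrite subrr.
Qed.

Lemma maxopP a x i : dom (maxop a) x -> '[maxop a x, b i] = '[x, a i].
Proof. by move=> dx; exact: (xgetPex 0 dx i). Qed.

Lemma maxop_linear a : linear_operator (maxop a).
Proof.
have lin (c : R[i]) x y : dom (maxop a) x -> dom (maxop a) y ->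
    dom (maxop a) (c *: x + y) /\ maxop a (c *: x + y) = c *: maxop a x + maxop a y.
  by move=> dx dy; apply: maxopE => i; rewrite !hdotDl !hdotZl !maxopP.
split; last by move=> c x y dx dy; have [] := lin c x y dx dy.
split; last by move=> c x y dx dy; have [] := lin c x y dx dy.
by have [] := @maxopE a 0 0 _ => // i; rewrite !hdot0l.
Qed.

Lemma gram_transfer (a a' : I -> H) (s t : seq I) (c d : I -> R[i]) :
  (forall i j, '[a i, a j] = '[a' i, a' j]) ->
  '[\sum_(i <- s) c i *: a i, \sum_(j <- t) d j *: a j] =
  '[\sum_(i <- s) c i *: a' i, \sum_(j <- t) d j *: a' j].
Proof.
move=> aa; rewrite !hdot_suml; apply: eq_bigr => i _; rewrite !hdot_sumr.
by apply: eq_bigr => j _; rewrite !hdotZl !hdotZr aa.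
Qed.

(** Equal Gram matrices make the replacement of [a] by [a'] in finite combinations isometric, so
    convergence on one side forces it on the other, with limits of the same norm. *)
Lemma maxop_transfer (a a' : I -> H) x y :
  (forall i j, '[a i, b j] = '[b i, a' j]) ->
  (forall i j, '[a i, a j] = '[a' i, a' j]) ->
  finite_approx a x y ->
  exists2 z, (forall i, '[z, b i] = '[x, a i]) & nsq z = nsq y.
Proof.
move=> ab aa [s [c [ux vy]]].
pose w n := \sum_(i <- s n) c n i *: a' i.
have [z wz] : exists z : H, w @ \oo --> z.
  apply: (@cvg_dominated _ _ _ _ (cvg_nsq_cauchy vy) 1) => m n; rewrite mul1r le_eqVlt.
  apply/orP; left; apply/eqP; rewrite !nsqB /nsq /w.
  by rewrite -!(gram_transfer _ _ _ _ aa).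
exists z.
  move=> i; apply: (eq_cvg_hdot wz ux) => n; rewrite !hdot_suml; apply: eq_bigr => j _.
  by rewrite !hdotZl hdotC -ab -hdotC.
apply: complexI; rewrite !nsqE.
have h1 := cvg_nsq wz; have h2 := cvg_nsq vy; rewrite -!nsqE; congr (_%:C).
have e : (fun n => nsq (w n)) = (fun n => nsq (\sum_(i <- s n) c n i *: a i)).
  by apply/funext => n; rewrite /nsq (gram_transfer _ _ _ _ aa).
rewrite e in h1.
by apply: (cvg_unique _ h1 h2).
Qed.

(** The first two hypotheses express formal normality on the span. The last two say that the maximal
    operators are graph limits of the minimal ones; this is what makes the adjoint computable and
    its domain the same. *)
Lemma maxop_normal (a a' : I -> H) :
  (forall i j, '[a i, b j] = '[b i, a' j]) ->
  (forall i j, '[a i, a j] = '[a' i, a' j]) ->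
  (forall x y, (forall i, '[y, b i] = '[x, a' i]) -> finite_approx a x y) ->
  (forall x y, (forall i, '[y, b i] = '[x, a i]) -> finite_approx a' x y) ->
  normal_op (maxop a').
Proof.
move=> ab aa C1 C2.
have ba i j : '[a' i, b j] = '[b i, a j] by rewrite hdotC -ab -hdotC.
have db i : dom (maxop a') (b i) /\ maxop a' (b i) = a i by apply: maxopE => j; exact: ab.
have dN : densely_defined (maxop a').
  apply/denseE; apply: orth_total_closure; first by case: (maxop_linear a').
  by move=> z hz; apply: b_total => i; rewrite hdotC hz ?conjc0 //; have [] := db i.
have adjP y z : (forall i, '[z, b i] = '[y, a i]) ->
    dom (adj_op (maxop a')) y /\ adj_op (maxop a') y = z.
  move=> hz; apply: adj_opE => // x dx.
  have [s [c [ux vNx]]] := C1 x (maxop a' x) (fun i => maxopP i dx).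
  apply: (eq_cvg_hdot vNx ux) => n; rewrite !hdot_suml; apply: eq_bigr => i _.
  by rewrite !hdotZl; congr (_ * _); rewrite hdotC -hz -hdotC.
have dom_adj y : dom (adj_op (maxop a')) y ->
    forall i, '[adj_op (maxop a') y, b i] = '[y, a i].
  move=> dy i; rewrite hdotC -adj_opP //; last by have [] := db i.
  by have [_ ->] := db i; rewrite -hdotC.
have tr x : dom (maxop a') x -> dom (adj_op (maxop a')) x /\
    nsq (adj_op (maxop a') x) = nsq (maxop a' x).
  move=> dx; have [z hz nz] := maxop_transfer ab aa (C1 _ _ (fun i => maxopP i dx)).
  by have [dz ->] := adjP _ _ hz.
split; [exact: maxop_linear | exact: dN | | ].
  apply/seteqP; split=> x; first by move=> /tr[].
  move=> dx; have [] := maxop_transfer ba _ (C2 _ _ (dom_adj _ dx)) => // z hz _.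
  by exists z.
by move=> x dx; rewrite !norm_nsq; have [_ ->] := tr x dx.
Qed.

End MaximalOperator.

(** * The normal extension for q = 1: two modes *)

Section TwoModes.
Context {R : realType} {H : hilbertType R}.
Variable B : nat -> nat -> H.
Hypothesis oB : forall m n k l, '[B m n, B k l] = ((m == k) && (n == l))%:R.
Implicit Types (x y z : H) (m n k l N : nat).

Let rt m : R[i] := (Num.sqrt m%:R)%:C.

(* [a^* (x) 1 + 1 (x) b], formally normal since the commutators of the two modes
   cancel. *)
Definition creation m n := rt m.+1 *: B m.+1 n + rt n *: B m n.-1.
Definition annihilation m n := rt m *: B m.-1 n + rt n.+1 *: B m n.+1.

Lemma two_modes_adj m n k l : '[creation m n, B k l] = '[B m n, annihilation k l].
Proof.
rewrite hdotDl hdotDr !hdotZl !hdotZr !conjc_real !oB; congr (_ + _).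
  case: k => [|k]; first by rewrite andFb mulr0 /rt sqrtr0 mul0r.
  by rewrite eqSS; case: eqP => [->|_] //; rewrite !mulr0.
case: n => [|n]; first by rewrite /rt sqrtr0 mul0r andbF mulr0.
by rewrite eqSS /=; case: (n =P l) => [->|_] //; rewrite !andbF !mulr0.
Qed.

Let rt2 m : rt m * rt m = m%:R.
Proof. by rewrite /rt -rmorphM -expr2 sqr_sqrtr ?ler0n // rmorph_nat. Qed.

(** The diagonal coefficients are [m.+1 + n] on the left and [m + n.+1] on the right; the mixed
    terms of one side are those of the other in exchanged order. *)
Lemma two_modes_gram m n k l :
  '[creation m n, creation k l] = '[annihilation m n, annihilation k l].
Proof.
rewrite !hdotDl !hdotDr !hdotZl !hdotZr !conjc_real !oB.
have -> : rt m.+1 * (rt k.+1 * ((m.+1 == k.+1) && (n == l))%:R) =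
  m.+1%:R * ((m == k) && (n == l))%:R.
  rewrite ?eqSS; case: eqP => [->|_]; last by rewrite !mulr0.
  by rewrite mulrA rt2.
have -> : rt n.+1 * (rt l.+1 * ((m == k) && (n.+1 == l.+1))%:R) =
  n.+1%:R * ((m == k) && (n == l))%:R.
  rewrite ?eqSS; case: (n =P l) => [->|_]; last by rewrite andbF !mulr0.
  by rewrite mulrA rt2.
have -> : rt m * (rt k * ((m.-1 == k.-1) && (n == l))%:R) =
  m%:R * ((m == k) && (n == l))%:R.
  case: m k => [|m] [|k] //=; rewrite /rt ?sqrtr0 ?mul0r ?mulr0 ?mul0r //.
  rewrite ?eqSS; case: eqP => [->|_]; last by rewrite !mulr0.
  by rewrite mulrA rt2.
have -> : rt n * (rt l * ((m == k) && (n.-1 == l.-1))%:R) =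
  n%:R * ((m == k) && (n == l))%:R.
  case: n l => [|n] [|l] //=; rewrite ?andbF /rt ?sqrtr0 ?mul0r ?mulr0 ?mul0r ?mulr0 //.
  rewrite ?eqSS; case: (n =P l) => [->|_]; last by rewrite andbF !mulr0.
  by rewrite mulrA rt2.
have -> : rt m.+1 * (rt l * ((m.+1 == k) && (n == l.-1))%:R) =
   rt n.+1 * (rt k * ((m == k.-1) && (n.+1 == l))%:R).
  case: k l => [|k] [|l] /=; rewrite ?andbF /rt ?sqrtr0 ?mul0r ?mulr0 ?mul0r ?mulr0 //.
  rewrite ?eqSS; case: eqP => [->|_]; last by rewrite !mulr0.
  case: (n =P l) => [->|_]; last by rewrite !mulr0.
  by rewrite mulrCA.
have -> : rt n * (rt k.+1 * ((m == k.+1) && (n.-1 == l))%:R) =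
   rt m * (rt l.+1 * ((m.-1 == k) && (n == l.+1))%:R).
  case: m n => [|m] [|n] /=; rewrite ?andbF /rt ?sqrtr0 ?mul0r ?mulr0 ?mul0r ?mulr0 //.
  rewrite ?eqSS; case: eqP => [->|_]; last by rewrite !mulr0.
  case: (n =P l) => [->|_]; last by rewrite !mulr0.
  by rewrite mulrCA.
rewrite -/(rt l.+1) -/(rt k) -!natr1; ring.
Qed.

End TwoModes.

Section WeightedSums.
Context {R : realType} {H : hilbertType R} {I : eqType}.
Variable b : I -> H.
Hypothesis b_orth : forall i j, '[b i, b j] = (i == j)%:R.
Hypothesis b_total : forall x, (forall i, '[x, b i] = 0) -> x = 0.
Variables (s : nat -> seq I) (w : nat -> I -> R).
Hypothesis s_uniq : forall n, uniq (s n).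
Hypothesis w01 : forall n i, 0 <= w n i <= 1.
Hypothesis w_cvg : forall j (ep : R), 0 < ep ->
  exists n0, forall n, (n0 <= n)%N -> j \in s n /\ (w n j - 1) ^+ 2 < ep.

Definition wsum n (x : H) := \sum_(i <- s n) ((w n i)%:C * '[x, b i]) *: b i.

Lemma wsum_lin n (c : R[i]) x y : wsum n (c *: x + y) = c *: wsum n x + wsum n y.
Proof.
rewrite /wsum scaler_sumr -big_split; apply: eq_bigr => i _ /=.
by rewrite hdotDl hdotZl mulrDr scalerDl scalerA mulrCA.
Qed.

Lemma wsumB n x y : wsum n (x - y) = wsum n x - wsum n y.
Proof.
have -> : x - y = (-1) *: y + x by rewrite scaleN1r addrC.
by rewrite wsum_lin scaleN1r addrC.
Qed.

Lemma nsq_wsum n x : nsq (wsum n x) <= nsq x.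
Proof.
rewrite (nsq_orthonormal_sum b_orth) // (le_trans _ (bessel b_orth x (s_uniq n))) //.
apply: ler_sum => i _; rewrite csqM csqR ler_piMl ?csq_ge0 //.
by have /andP[h1 h2] := w01 n i; rewrite expr_le1.
Qed.

(** The maps [wsum n] are contractions that converge on each basis vector, hence on a dense
    subspace, hence everywhere. *)
Lemma wsum_cvg x : (fun n => wsum n x) @ \oo --> x.
Proof.
pose L := [set z : H | (fun n => wsum n z) @ \oo --> z].
have Ls : linear_subspace L.
  split.
    rewrite /L /=; have -> : (fun n => wsum n 0) = (fun=> 0); last exact: cvg_cst.
    by apply/funext => n; rewrite /wsum big1 // => i _; rewrite hdot0l mulr0 scale0r.
  move=> c y z; rewrite /L /= => Ly Lz.
  have -> : (fun n => wsum n (c *: y + z)) = (fun n => c *: wsum n y + wsum n z).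
    by apply/funext => n; rewrite wsum_lin.
  exact: cvg_lin.
have Lb j : L (b j).
  rewrite /L /=; apply/cvg_nsqP => ep /(w_cvg j)[n0 hn0]; exists n0 => // n /= /hn0[js].
  apply: le_lt_trans; rewrite le_eqVlt; apply/orP; left.
  have -> : wsum n (b j) = (w n j)%:C *: b j.
    rewrite /wsum (bigD1_seq j) //= b_orth eqxx mulr1 big1 ?addr0 // => i ij.
    by rewrite b_orth eq_sym (negbTE ij) mulr0 scale0r.
  have -> : (w n j)%:C *: b j - b j = (w n j - 1)%:C *: b j.
    by rewrite rmorphB /= scalerBl scale1r.
  by rewrite nsqZ csqR /nsq b_orth eqxx mulr1.
have Lc : closure L x.
  rewrite orth_total_closure // => z hz; apply: b_total => i.
  by rewrite hdotC hz ?conjc0.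
apply/cvg_nsqP => ep ep0; have ep8 : 0 < ep / 16 by rewrite divr_gt0.
move/closure_nsqP: Lc => /(_ _ ep8)[z /cvg_nsqP/(_ _ ep8)[N _ hN] zx].
exists N => // n /= /hN {}hN.
apply: le_lt_trans (nsqB_le _ (wsum n z) _) _.
rewrite -wsumB; have := nsq_wsum n (x - z); rewrite (nsqBC x) => h1.
have := nsqB_le (wsum n z) z x; move: hN; lra.
Qed.

End WeightedSums.

Section TwoModesNormal.
Context {R : realType} {H : hilbertType R}.
Implicit Types (x y z : H) (m n k l N : nat).

Let rt m : R[i] := (Num.sqrt m%:R)%:C.

(** For positive [N], the linear profile max(0, 1 - m/N); truncated subtraction supplies the zero
    beyond [N]. *)
Definition cutoff N m : R := (N - m)%N%:R / N%:R.

Lemma cutoff01 N m : 0 <= cutoff N.+1 m <= 1.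
Proof.
by rewrite divr_ge0 //= ler_pdivrMr // mul1r ler_nat leq_subr.
Qed.

(** No boundary term survives: [G 0] vanishes at the lower end and the cut-off at the upper one. *)
Lemma cutoff_shift N c (G : nat -> H) : G 0%N = 0 ->
  \sum_(0 <= m < N) (cutoff N (m + c))%:C *: G m =
  \sum_(0 <= m < N) (cutoff N (m.+1 + c))%:C *: G m.+1.
Proof.
move=> G0; apply/eqP; rewrite eq_sym -subr_eq0 -sumrB.
rewrite (telescope_sumr (fun m => (cutoff N (m + c))%:C *: G m)) //.
rewrite G0 scaler0 subr0 /cutoff.
have -> : (N - (N + c))%N = 0%N by lia.
by rewrite mul0r scale0r.
Qed.

(** A step of the cut-off is nonzero only for [m + n <= N]; there it equals [1 / N.+1], while the
    factor [m.+1] is at most [N.+1]. *)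
Lemma cutoff_diff N m n : (cutoff N.+1 (m + n) - cutoff N.+1 (m + n).+1) ^+ 2 * m.+1%:R
  <= N.+1%:R^-1.
Proof.
have N0 : (0 : R) < N.+1%:R by rewrite ltr0n.
have -> : cutoff N.+1 (m + n) - cutoff N.+1 (m + n).+1 = (m + n < N.+1)%N%:R / N.+1%:R.
  rewrite /cutoff -mulrBl; congr (_ / _); case: ltnP => h.
    have -> : (N.+1 - (m + n) = (N.+1 - (m + n).+1).+1)%N by lia.
    by rewrite -natr1 addrAC subrr add0r.
  have -> : (N.+1 - (m + n) = 0)%N by lia.
  have -> : (N.+1 - (m + n).+1 = 0)%N by lia.
  by rewrite subrr.
case: ltnP => h; last by rewrite mul0r expr0n mul0r invr_ge0 ltW.
have : m.+1%:R <= N.+1%:R :> R by rewrite ler_nat; lia.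
rewrite mul1r expr2 -mulrA => h1; rewrite -[leRHS]mulr1 ler_wpM2l ?invr_ge0 ?(ltW N0) //.
by rewrite mulrC ler_pdivrMr // mul1r.
Qed.

Definition square N := [seq (m, n) | m <- index_iota 0 N, n <- index_iota 0 N].

Lemma square_uniq N : uniq (square N).
Proof.
apply: allpairs_uniq; [exact: iota_uniq | exact: iota_uniq |].
by move=> [? ?] [? ?] _ _ [-> ->].
Qed.

Lemma mem_square N m n : ((m, n) \in square N) = (m < N)%N && (n < N)%N.
Proof.
apply/allpairsP/andP => [[[? ?] [/= h1 h2 [-> ->]]]|[h1 h2]].
  by move: h1 h2; rewrite !mem_index_iota.
by exists (m, n); rewrite !mem_index_iota.
Qed.

Lemma nsq_weighted_family N (g h : nat -> nat -> H) (c : nat -> nat -> R[i]) x (M : R) :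
  (forall m n k l, '[g m n, g k l] = ((m == k) && (n == l))%:R) ->
  (forall m n k l, '[h m n, h k l] = ((m == k) && (n == l))%:R) ->
  0 <= M -> (forall m n, csq (c m n) <= M) ->
  nsq (\sum_(0 <= m < N) \sum_(0 <= n < N) (c m n * '[x, h m n]) *: g m n) <= M * nsq x.
Proof.
move=> og oh M0 cM.
have og' (p r : nat * nat) : '[g p.1 p.2, g r.1 r.2] = (p == r)%:R.
  by case: p r => [? ?] [? ?]; rewrite og.
have oh' (p r : nat * nat) : '[h p.1 p.2, h r.1 r.2] = (p == r)%:R.
  by case: p r => [? ?] [? ?]; rewrite oh.
have -> : \sum_(0 <= m < N) \sum_(0 <= n < N) (c m n * '[x, h m n]) *: g m n =
    \sum_(p <- square N) (c p.1 p.2 * '[x, h p.1 p.2]) *: g p.1 p.2.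
  by rewrite big_allpairs.
rewrite (nsq_orthonormal_sum og') ?square_uniq //.
apply: le_trans (ler_wpM2l M0 (bessel oh' x (square_uniq N))).
rewrite mulr_sumr; apply: ler_sum => -[m n] _ /=.
by rewrite csqM ler_wpM2r ?csq_ge0.
Qed.

Section Basis.
Variable B : nat -> nat -> H.
Hypothesis oB : forall m n k l, '[B m n, B k l] = ((m == k) && (n == l))%:R.
Hypothesis tB : forall x, (forall m n, '[x, B m n] = 0) -> x = 0.

Let b (p : nat * nat) := B p.1 p.2.
Let w N (p : nat * nat) : R := cutoff N.+1 (p.1 + p.2).

Let b_orth p r : '[b p, b r] = (p == r)%:R.
Proof. by case: p r => [? ?] [? ?]; rewrite /b oB. Qed.

Let b_total x : (forall p, '[x, b p] = 0) -> x = 0.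
Proof. by move=> h; apply: tB => m n; exact: (h (m, n)). Qed.

Lemma cutoff_sum_cvg x : (fun N => wsum b (fun N => square N.+1) w N x) @ \oo --> x.
Proof.
apply: (wsum_cvg b_orth b_total) => [n|n i|[m n] ep ep0].
- exact: square_uniq.
- exact: cutoff01.
have ep1 : 0 < Num.min ep 1 by rewrite lt_min ep0 ltr01.
have c0 : 0 < (m + n).+1%:R :> R by rewrite ltr0n.
have [N0 _ hN0] := invn_cvg0 (divr_gt0 ep1 c0).
exists (maxn N0 (m + n)) => N; rewrite geq_max => /andP[h1 h2].
split; first by rewrite mem_square; lia.
have /= := hN0 _ h1; rewrite ltr_pdivlMr // lt_min => /andP[h3 h4].
rewrite /w /cutoff /= natrB; last by lia.
have Np : 0 < N.+1%:R :> R by rewrite ltr0n.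
have -> : (N.+1%:R - (m + n)%:R) / N.+1%:R - 1 = - (N.+1%:R^-1 * (m + n)%:R) :> R.
  by field; rewrite gt_eqF.
rewrite sqrrN; move: h3 h4; set t := N.+1%:R^-1.
have t0 : 0 < t by rewrite invr_gt0.
have := ler0n R (m + n); rewrite -natr1; set r := (m + n)%:R => *.
have : 0 <= t * r by rewrite mulr_ge0 // ltW.
nra.
Qed.

(* The cut-off by the total number [m + n] varies by [1 / N] at each step, against
   coefficients of size [sqrt N], so its commutator with [creation] vanishes in the
   limit. *)
Lemma two_modes_approx x y : (forall m n, '[y, B m n] = '[x, annihilation B m n]) ->
  finite_approx b (fun p => creation B p.1 p.2) x y.
Proof.
move=> yx; exists (fun N => square N.+1), (fun N p => (w N p)%:C * '[x, b p]).
split; first exact: cutoff_sum_cvg.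
pose X N := wsum b (fun N => square N.+1) w N y.
pose xx m n := '[x, B m n].
pose V N := \sum_(p <- square N.+1) ((w N p)%:C * '[x, b p]) *: creation B p.1 p.2.
pose G n m := (rt m * xx m.-1 n) *: B m n.
pose K m n := (rt n * xx m n) *: B m n.-1.
pose dl N s : R[i] := (cutoff N.+1 s - cutoff N.+1 s.+1)%:C.
have G0 n : G n 0%N = 0 by rewrite /G /rt sqrtr0 mul0r scale0r.
have K0 m : K m 0%N = 0 by rewrite /K /rt sqrtr0 mul0r scale0r.
have VE N : V N = \sum_(0 <= m < N.+1) \sum_(0 <= n < N.+1)
    (cutoff N.+1 (m + n))%:C *: (G n m.+1 + K m n).
  rewrite /V big_allpairs; apply: eq_bigr => m _; apply: eq_bigr => n _.
  rewrite /w /b /= /creation -scalerA; congr (_ *: _).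
  by rewrite scalerDr !scalerA /G /K /= -/(xx m n) ![xx m n * _]mulrC.
have XE N : X N = \sum_(0 <= m < N.+1) \sum_(0 <= n < N.+1)
    (cutoff N.+1 (m + n))%:C *: (G n m + K m n.+1).
  rewrite /X /wsum big_allpairs; apply: eq_bigr => m _; apply: eq_bigr => n _.
  rewrite /w /b /= -scalerA yx; congr (_ *: _).
  by rewrite /annihilation hdotDr !hdotZr !conjc_real scalerDl.
(* The two sums contain the same terms with weights one step apart. Shifting n in the [K] part of
   [V] and m in the [G] part of [X] aligns them, leaving one cut-off increment per term. *)
have VX N : V N - X N =
    \sum_(0 <= m < N.+1) \sum_(0 <= n < N.+1) (dl N (m + n)%N * rt m.+1 * xx m n) *: B m.+1 n
  - \sum_(0 <= m < N.+1) \sum_(0 <= n < N.+1) (dl N (m + n)%N * rt n.+1 * xx m n.+1) *: B m n.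
  have -> : V N = \sum_(0 <= m < N.+1) \sum_(0 <= n < N.+1)
       (cutoff N.+1 (m + n))%:C *: G n m.+1 +
     \sum_(0 <= m < N.+1) \sum_(0 <= n < N.+1) (cutoff N.+1 (m + n).+1)%:C *: K m n.+1.
    rewrite VE -big_split; apply: eq_bigr => m _ /=.
    have -> : \sum_(0 <= n < N.+1) (cutoff N.+1 (m + n).+1)%:C *: K m n.+1 =
        \sum_(0 <= n < N.+1) (cutoff N.+1 (n.+1 + m))%:C *: K m n.+1.
      by apply: eq_bigr => n _; rewrite addSn addnC.
    rewrite -cutoff_shift // -big_split; apply: eq_bigr => n _ /=.
    by rewrite scalerDr (addnC n).
  have -> : X N = \sum_(0 <= m < N.+1) \sum_(0 <= n < N.+1)
       (cutoff N.+1 (m + n).+1)%:C *: G n m.+1 +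
     \sum_(0 <= m < N.+1) \sum_(0 <= n < N.+1) (cutoff N.+1 (m + n))%:C *: K m n.+1.
    rewrite XE [X in _ = X + _]exchange_big /=.
    have -> : \sum_(0 <= n < N.+1) \sum_(0 <= m < N.+1)
        (cutoff N.+1 (m + n).+1)%:C *: G n m.+1 =
      \sum_(0 <= m < N.+1) \sum_(0 <= n < N.+1) (cutoff N.+1 (m + n))%:C *: G n m.
      rewrite [RHS]exchange_big /=; apply: eq_bigr => n _.
      rewrite cutoff_shift //.
    rewrite -big_split; apply: eq_bigr => m _ /=.
    by rewrite -big_split; apply: eq_bigr => n _ /=; rewrite scalerDr.
  rewrite opprD addrACA; congr (_ + _).
    rewrite -sumrB; apply: eq_bigr => m _; rewrite -sumrB; apply: eq_bigr => n _.
    by rewrite -scalerBl /G scalerA /dl rmorphB mulrA.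
  rewrite -opprB; congr (- _).
  rewrite -sumrB; apply: eq_bigr => m _; rewrite -sumrB; apply: eq_bigr => n _.
  by rewrite -scalerBl /K scalerA /dl rmorphB mulrA.
have bound N : nsq (V N - X N) <= 4 / N.+1%:R * nsq x.
  rewrite VX -[X in nsq (_ + X)]opprK; apply: le_trans (nsqD_le _ _) _.
  rewrite opprK nsqN.
  have M0 : 0 <= N.+1%:R^-1 :> R by rewrite invr_ge0.
  have csq_rt m : csq (rt m) = m%:R by rewrite csqR sqr_sqrtr.
  have oB1 m n k l : '[B m.+1 n, B k.+1 l] = ((m == k) && (n == l))%:R by rewrite oB eqSS.
  have oB2 m n k l : '[B m n.+1, B k l.+1] = ((m == k) && (n == l))%:R by rewrite oB eqSS.
  have h1 := nsq_weighted_family N.+1 (c := fun m n => dl N (m + n)%N * rt m.+1) x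
    oB1 oB M0.
  have h2 := nsq_weighted_family N.+1 (c := fun m n => dl N (m + n)%N * rt n.+1) x
    oB oB2 M0.
  apply: le_trans (lerD (ler_wpM2l _ (h1 _)) (ler_wpM2l _ (h2 _))) _ => //.
  - by move=> m n; rewrite csqM csqR csq_rt cutoff_diff.
  - by move=> m n; rewrite csqM csqR csq_rt (addnC m) cutoff_diff.
  - by rewrite le_eqVlt; apply/orP; left; apply/eqP; ring.
apply/cvg_nsqP => ep ep0.
have c0 : 0 < 4 * nsq x + 1 by have := nsq_ge0 x; lra.
have ep4 : 0 < ep / 4 by rewrite divr_gt0.
have /cvg_nsqP/(_ _ ep4)[N1 _ hN1] := cutoff_sum_cvg (x := y).
have [N2 _ hN2] := invn_cvg0 (divr_gt0 ep4 c0).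
exists (maxn N1 N2) => // N /=; rewrite geq_max => /andP[/hN1 /= h1 /hN2 /= h2].
apply: le_lt_trans (nsqB_le _ (X N) _) _.
have := bound N; rewrite -/(V N); move: h1 h2; rewrite -/(X N) (ltr_pdivlMr _ _ c0).
have : 0 < N.+1%:R^-1 :> R by rewrite invr_gt0 ltr0n.
move: (N.+1%:R^-1) => t; nra.
Qed.

End Basis.
End TwoModesNormal.

(** Serves to index a basis of [H] by pairs; the injection only witnesses that [T] is infinite. *)
Lemma nat_enumeration (T : countType) (j : nat -> T) : injective j ->
  exists (f : T -> nat) (g : nat -> T), cancel f g /\ cancel g f.
Proof.
move=> ij.
have /card_set_bijP[f] : ([set: T] #= [set: nat])%card.
  apply: eq_card_nat; first exact: countableP.
  apply/infiniteP/card_subP; exists (range j) => //.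
  by apply: inj_card_eq => m n _ _; exact: ij.
by rewrite setTT_bijective => -[g fg gf]; exists f, g.
Qed.

Section NormalModel.
Context {R : realType} {H : hilbertType R}.

(** The [g n] need not be total: the isometry sending a basis to them embeds [H] into itself so that
    [N] extends the creation operator. *)
Definition normal_model (q : R) := exists (N : operator H) (g : nat -> H),
  [/\ normal_op N, orthonormal_seq g &
      forall n, dom N (g n) /\ N (g n) = (Num.sqrt (qint q n.+1))%:C *: g n.+1].

Lemma normal_model1 (e : nat -> H) : orthonormal_basis e -> normal_model 1.
Proof.
move=> be; have [oe _] := be.
have [f [t [ft tf]]] := @nat_enumeration (nat * nat)%type (fun n => (n, 0%N))
  (ltac:(by move=> ? ? [])).
pose B m n := e (f (m, n)).
have oB m n k l : '[B m n, B k l] = ((m == k) && (n == l))%:R.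
  by rewrite /B oe (can_eq ft) xpair_eqE.
have tB x : (forall m n, '[x, B m n] = 0) -> x = 0.
  move=> h; apply: (basis_total be) => n.
  by rewrite -(tf n); case: (t n) => k l; exact: h.
pose b (p : nat * nat) := B p.1 p.2.
pose a (p : nat * nat) := creation B p.1 p.2.
pose a' (p : nat * nat) := annihilation B p.1 p.2.
have tb x : (forall p, '[x, b p] = 0) -> x = 0 by move=> h; apply: tB => m n; exact: (h (m, n)).
have C1 x y : (forall p, '[y, b p] = '[x, a' p]) -> finite_approx b a x y.
  by move=> h; apply: two_modes_approx => // m n; exact: (h (m, n)).
(* Exchanging the modes turns [annihilation] into [creation], so the approximation result for [B']
   gives this half. *)
have C2 x y : (forall p, '[y, b p] = '[x, a p]) -> finite_approx b a' x y.
  move=> h; pose B' m n := B n m.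
  have oB' m n k l : '[B' m n, B' k l] = ((m == k) && (n == l))%:R by rewrite oB andbC.
  have tB' z : (forall m n, '[z, B' m n] = 0) -> z = 0 by move=> hz; apply: tB => m n; exact: hz.
  have [|s [c [c1 c2]]] := @two_modes_approx R H B' oB' tB' x y.
    by move=> m n; rewrite (h (n, m)) /a /creation /annihilation addrC.
  pose sw (p : nat * nat) := (p.2, p.1).
  exists (fun N => map sw (s N)), (fun N p => c N (sw p)); split.
    move: c1; set u := (fun _ => _); set v := (fun _ => _); suff -> : u = v by [].
    by apply/funext => N; rewrite /u /v big_map; apply: eq_bigr => -[].
  move: c2; set u := (fun _ => _); set v := (fun _ => _); suff -> : u = v by [].
  apply/funext => N; rewrite /u /v big_map; apply: eq_bigr => -[m n] _ /=.
  by rewrite /a' /creation /annihilation addrC.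
(* With the second mode in its vacuum the second summand of [creation] vanishes, and the first one
   is the ordinary creation operator. *)
exists (maxop b a'), (fun n => B n 0%N); split.
- by apply: (maxop_normal tb _ _ C1 C2) => -[m n] [k l];
    [exact: two_modes_adj | exact: two_modes_gram].
- by move=> m n; rewrite oB andbT.
move=> n; apply: maxopE => // -[k l].
rewrite -(two_modes_adj oB n 0 k l) /creation sqrtr0 scale0r addr0.
congr ('[(Num.sqrt _)%:C *: _, _]).
by rewrite /qint (eq_bigr (fun=> 1)) => [|i _]; rewrite ?expr1n // sumr_const card_ord.
Qed.

End NormalModel.

(** * The isometry carrying a basis to an orthonormal sequence *)

Section Isometry.
Context {R : realType} {H : hilbertType R}.
Variables (e g : nat -> H).
Hypothesis be : orthonormal_basis e.
Hypothesis og : orthonormal_seq g.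

Let I_ex x : exists y : H, (fun n => \sum_(0 <= i < n) '[x, e i] *: g i) @ \oo --> y.
Proof.
have [oe _] := be.
have [n|y h _] := @riesz_fischer _ _ g (fun i => '[x, e i]) (nsq x) og; last by exists y.
by rewrite (bessel oe) ?iota_uniq.
Qed.

Definition isometry_fun x : H := projT1 (cid (I_ex x)).

Lemma isometry_cvg x :
  (fun n => \sum_(0 <= i < n) '[x, e i] *: g i) @ \oo --> isometry_fun x.
Proof. by rewrite /isometry_fun; case: cid. Qed.

Lemma isometry_linear : linear isometry_fun.
Proof.
move=> a x y.
suff E : isometry_fun (a *: x + y) = a *: isometry_fun x + isometry_fun y by exact: E.
apply: (cvg_uniq (isometry_cvg (x := a *: x + y))).
have := cvg_lin (a := a) (isometry_cvg (x := x)) (isometry_cvg (x := y)).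
set u := (fun _ => _); set v := (fun _ => _); suff -> : u = v by [].
apply/funext => n; rewrite /u /v scaler_sumr -big_split; apply: eq_bigr => i _ /=.
by rewrite hdotDl hdotZl scalerDl scalerA.
Qed.

HB.instance Definition _ := GRing.isLinear.Build R[i] H H *:%R isometry_fun isometry_linear.

Lemma isometry_basis n : isometry_fun (e n) = g n.
Proof.
apply: (cvg_uniq (isometry_cvg (x := e n))); apply/cvg_nsqP => ep ep0.
exists n.+1 => // m /= nm; have [oe _] := be.
rewrite (bigD1_seq n) ?iota_uniq ?mem_index_iota //= oe eqxx scale1r big1 ?addr0.
  by rewrite subrr nsq0.
by move=> i ni; rewrite oe eq_sym (negbTE ni) scale0r.
Qed.

Lemma isometry_dot x y : '[isometry_fun x, isometry_fun y] = '[x, y].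
Proof.
have gy i : '[g i, isometry_fun y] = '[e i, y].
  have [oe _] := be.
  rewrite -isometry_basis hdotC (hdotC (e i)); congr (_^*)%C.
  apply: (eq_cvg_hdot (isometry_cvg (x := y)) (psum_cvg (x := y) be)) => n.
  rewrite isometry_basis (hdot_orthonormal_sum og) ?iota_uniq //.
  by rewrite (hdot_orthonormal_sum oe) ?iota_uniq.
apply: (eq_cvg_hdot (isometry_cvg (x := x)) (psum_cvg (x := x) be)) => n.
rewrite !hdot_suml; apply: eq_bigr => i _.
by rewrite !hdotZl gy.
Qed.

End Isometry.

Lemma isometry_exists (R : realType) (H : hilbertType R) (e g : nat -> H) :
  orthonormal_basis e -> orthonormal_seq g ->
  exists J : {linear H -> H},
    (forall x y, '[J x, J y] = '[x, y]) /\ forall n, J (e n) = g n.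
Proof.
move=> be og; exists (isometry_fun be og); split.
  exact: isometry_dot.
exact: isometry_basis.
Qed.

(** * A discrete measure with moments [n]_q! up to a factor, for q > 1 *)

Section RatioTest.
Context {R : realType}.

Lemma ratio_test (a : nat -> R) (K : nat) (t : R) : (forall k, 0 <= a k) ->
  0 <= t < 1 -> (forall k, (K <= k)%N -> a k.+1 <= t * a k) ->
  exists M, forall n, \sum_(0 <= i < n) a i <= M.
Proof.
move=> a0 /andP[t0 t1] aK; have t1' : 0 < 1 - t by lra.
have t1n : 1 - t != 0 by rewrite gt_eqF.
(* Partial sum plus a bound for the geometric tail; this quantity does not increase as the partial
   sum is prolonged. *)
pose M := \sum_(0 <= i < K) a i + a K / (1 - t); exists M => n.
have h m : \sum_(0 <= i < K + m) a i + a (K + m)%N / (1 - t) <= M.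
  elim: m => [|m IH]; first by rewrite addn0.
  apply: le_trans IH; rewrite addnS big_nat_recr //= -addrA lerD2l.
  have := aK (K + m)%N (leq_addr _ _).
  rewrite -[X in X + _](mulfK t1n) -mulrDl ler_pM2r ?invr_gt0 //; lra.
apply: le_trans (h n); rewrite addnC [leRHS]addrC.
rewrite [X in _ + X](big_cat_nat (n := n)) ?leq_addr //= addrCA lerDl.
by rewrite addr_ge0 ?sumr_ge0 // divr_ge0 // ltW.
Qed.

Lemma expr_unbounded (x M : R) : 1 < x -> exists K, forall k, (K <= k)%N -> M <= x ^+ k.
Proof.
move=> x1; have x0 : 0 < x - 1 by lra.
have bern k : 1 + k%:R * (x - 1) <= x ^+ k.
  elim: k => [|k IH]; first by rewrite mul0r addr0 expr0.
  rewrite exprS -natr1; have : 0 <= k%:R * (x - 1) by rewrite mulr_ge0 ?ler0n ?ltW.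
  nra.
exists (Num.truncn (M / (x - 1))).+1 => k Kk; apply: le_trans (bern k).
have : M / (x - 1) < k%:R by apply: lt_le_trans (truncnS_gt _) _; rewrite ler_nat.
rewrite ltr_pdivrMr //; lra.
Qed.

End RatioTest.

Section Weights.
Context {R : realType}.
Variable q : R.
Hypothesis q1 : 1 < q.

(* [qradius z] stands for [q ^ (- z)], and [qweight] solves the two-sided recursion
   of the discrete q-Laguerre measure, whose n-th qmoment is [n]_q! up to a factor. *)
Definition qradius (z : int) : R :=
  match z with Posz k => q^-1 ^+ k | Negz k => q ^+ k.+1 end.

Definition qweight (z : int) : R :=
  match z with
  | Posz k => \prod_(0 <= i < k) (q^-1 * (1 + (q - 1) * q^-1 ^+ i))
  | Negz k => \prod_(0 <= i < k.+1) (q^-1 * (1 + (q - 1) * q ^+ i.+1))^-1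
  end.

Let q0 : 0 < q. Proof. exact: lt_trans q1. Qed.
Let qn0 : q != 0. Proof. by rewrite gt_eqF. Qed.
Let p0 : 0 < q^-1. Proof. by rewrite invr_gt0. Qed.

Lemma qradius_gt0 z : 0 < qradius z.
Proof. by case: z => k; rewrite exprn_gt0. Qed.

Let factor_gt0 (x : R) : 0 < x -> 0 < q^-1 * (1 + (q - 1) * x).
Proof. by move=> x0; rewrite mulr_gt0 // addr_gt0 // mulr_gt0 // subr_gt0. Qed.

Lemma qweight_gt0 z : 0 < qweight z.
Proof.
by case: z => k; apply: prodr_gt0 => i _; rewrite ?invr_gt0 factor_gt0 // exprn_gt0.
Qed.

Let NegzS k : Negz k.+1 + 1 = Negz k. Proof. by rewrite !NegzE; lia. Qed.

Lemma qradiusS z : qradius (z + 1) = q^-1 * qradius z.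
Proof.
case: z => [k|[|k]].
- have -> : Posz k + 1 = Posz k.+1 by lia.
  by rewrite /= exprS.
- by rewrite /= expr1 mulVf.
- by rewrite NegzS /= [in RHS]exprS mulKf.
Qed.

Lemma qweightS z : qweight (z + 1) = q^-1 * (1 + (q - 1) * qradius z) * qweight z.
Proof.
case: z => [k|[|k]].
- have -> : Posz k + 1 = Posz k.+1 by lia.
  by rewrite /= big_nat_recr //= mulrC.
- rewrite /= big_nil big_nat1 mulfV // gt_eqF //.
  by rewrite factor_gt0 // exprn_gt0.
- rewrite NegzS [in RHS]/qweight big_nat_recr // [RHS]mulrC -mulrA mulVf ?mulr1 //.
  by rewrite gt_eqF // factor_gt0 // exprn_gt0.
Qed.

Definition qmoment n z := qradius z ^+ n * qweight z.

Lemma qmoment_gt0 n z : 0 < qmoment n z.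
Proof. by rewrite mulr_gt0 ?qweight_gt0 // exprn_gt0 // qradius_gt0. Qed.

Lemma qmomentSn n z : qmoment n.+1 z = qradius z * qmoment n z.
Proof. by rewrite /qmoment exprS mulrA. Qed.

(** Summation over all integers does not see the shift of [z], so the total moments satisfy m_n =
    q^(-n-1) (m_n + (q - 1) m_(n+1)), that is m_(n+1) = [n+1]_q m_n. *)
Lemma qmomentS n z :
  qmoment n (z + 1) = q^-1 ^+ n.+1 * (qmoment n z + (q - 1) * qmoment n.+1 z).
Proof. by rewrite qmomentSn /qmoment qradiusS qweightS exprMn exprS; ring. Qed.

Lemma moment_pos_summable n :
  exists M, forall N, \sum_(0 <= k < N) qmoment n (Posz k) <= M.
Proof.
have [K hK] := expr_unbounded 2 q1.
(* Towards small radii the ratio is at most q^(-1) (1 + (q - 1) [qradius k]), which is at most (1 +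
   q^(-1)) / 2 once the radius is below 1/2; hence the 2 in the choice of [K]. *)
apply: (@ratio_test _ _ K ((1 + q^-1) / 2)); first by move=> k; rewrite ltW // qmoment_gt0.
  have h : q^-1 < 1 by rewrite invf_lt1.
  by have p0' := p0; apply/andP; split; lra.
move=> k /hK qk; have -> : Posz k.+1 = Posz k + 1 by lia.
rewrite qmomentS qmomentSn; have m0 := qmoment_gt0 n (Posz k).
have -> : q^-1 ^+ n.+1 * (qmoment n k + (q - 1) * (qradius k * qmoment n k)) =
  q^-1 ^+ n.+1 * (1 + (q - 1) * qradius k) * qmoment n k by ring.
rewrite ler_pM2r //.
have qk0 : 0 < q ^+ k by rewrite exprn_gt0.
have r2 : qradius k <= 2^-1 by rewrite /= exprVn lef_pV2 // posrE.
have pn : q^-1 ^+ n.+1 <= q^-1.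
  by rewrite exprS ler_piMr ?(ltW p0) // exprn_ile1 ?(ltW p0) // invf_le1 // ltW.
have f0 : 0 < 1 + (q - 1) * qradius k.
  by rewrite addr_gt0 // mulr_gt0 ?qradius_gt0 // subr_gt0.
apply: le_trans (ler_wpM2r (ltW f0) pn) _.
have : q^-1 * (1 + (q - 1) * qradius k) <= q^-1 * (1 + (q - 1) * 2^-1).
  by rewrite ler_pM2l // lerD2l ler_pM2l // subr_gt0.
move/le_trans; apply.
have -> : q^-1 * (1 + (q - 1) * 2^-1) = (1 + q^-1) / 2 by field.
by [].
Qed.

Lemma moment_neg_summable n :
  exists M, forall N, \sum_(0 <= k < N) qmoment n (Negz k) <= M.
Proof.
(* Towards large radii consecutive terms have ratio q^(n+1) / (1 + (q - 1) q^(k+2)), at most 1/2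
   once q^(k+2) reaches this bound. *)
have [K hK] := expr_unbounded (2 * q ^+ n.+1 / (q - 1)) q1.
apply: (@ratio_test _ _ K (2^-1)); first by move=> k; rewrite ltW // qmoment_gt0.
  by lra.
move=> k Kk; have qk : 2 * q ^+ n.+1 / (q - 1) <= q ^+ k.+2 by apply: hK; lia.
have qm : 0 < q - 1 by rewrite subr_gt0.
rewrite ler_pdivrMr // in qk.
rewrite -(NegzS k) qmomentS qmomentSn; have m0 := qmoment_gt0 n (Negz k.+1).
have -> : qradius (Negz k.+1) = q ^+ k.+2 by [].
have qn : 0 < q ^+ n.+1 by rewrite exprn_gt0.
rewrite exprVn -ler_pdivrMl ?invr_gt0 // invrK ler_pdivlMl //.
move: qk qn m0; set u := q ^+ k.+2; set v := q ^+ n.+1; set m := qmoment _ _ => *.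
nra.
Qed.

End Weights.

(** * Multiplication by z on a family of circles, for q > 1 *)

Section DiscreteModel.
Context {R : realType} {H : hilbertType R}.
Implicit Types (x y z : H).

(** Riesz-Fischer over the integers: the two half-lines are summed separately and have orthogonal
    supports. *)
Lemma two_sided_sum (e : nat -> H) (f : int -> nat) (c : int -> R[i]) (M1 M2 : R) :
  orthonormal_seq e -> injective f ->
  (forall n, \sum_(0 <= k < n) csq (c (Posz k)) <= M1) ->
  (forall n, \sum_(0 <= k < n) csq (c (Negz k)) <= M2) ->
  exists h, (forall k, '[h, e (f k)] = c k) /\
            (forall i, (forall k, i <> f k) -> '[h, e i] = 0).
Proof.
move=> oe fi hP hN.
have half (u : nat -> int) (M : R) : injective u ->
    (forall n, \sum_(0 <= k < n) csq (c (u k)) <= M) ->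
    exists y, (forall k, '[y, e (f (u k))] = c (u k)) /\
      (forall i, (forall k, i <> f (u k)) -> '[y, e i] = 0).
  move=> ui hu.
  have ou : orthonormal_seq (fun k => e (f (u k))).
    by move=> m n; rewrite oe (inj_eq fi) (inj_eq ui).
  have [y Sy yc] := riesz_fischer ou hu; exists y; split=> // i hi.
  have c0 : (fun _ : nat => 0 : H) @ \oo --> (0 : H) by exact: cvg_cst.
  rewrite (eq_cvg_hdot Sy c0 (x' := e i) (y' := e i)) ?hdot0l // => n.
  rewrite ?hdot0l hdot_suml big1 // => k _; rewrite hdotZl oe.
  by rewrite (_ : f (u k) == i = false) ?mulr0 //; apply/eqP => E; exact: (hi k).
have [y1 [c1 o1]] := half Posz _ (ltac:(by move=> ? ? [])) hP.
have [y2 [c2 o2]] := half Negz _ (ltac:(by move=> ? ? [])) hN.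
exists (y1 + y2); split=> [[k|k]|i hi]; rewrite hdotDl.
- by rewrite c1 o2 ?addr0 // => l /fi.
- by rewrite c2 o1 ?add0r // => l /fi.
- by rewrite o1 ?o2 ?addr0.
Qed.

Variables (q : R) (e : nat -> H).
Hypothesis q1 : 1 < q.
Hypothesis be : orthonormal_basis e.
Variables (f : int * int -> nat) (t : nat -> int * int).
Hypothesis ft : cancel f t.
Hypothesis tf : cancel t f.

Let oe : orthonormal_seq e. Proof. by case: be. Qed.
(** [b (k, j)] plays the j-th Fourier mode on the circle of squared radius q^(-k). Multiplication by
    z raises j by one and scales by the radius [r k]. *)
Let b (p : int * int) := e (f p).
Let r (k : int) : R := Num.sqrt (qradius q k).
Let up (p : int * int) := (p.1, p.2 + 1).
Let dn (p : int * int) := (p.1, p.2 - 1).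
Let rt (p : int * int) := (p.1 + 1, p.2).
Let lf (p : int * int) := (p.1 - 1, p.2).
Let a (p : int * int) : H := (r p.1)%:C *: b (up p).
Let a' (p : int * int) : H := (r p.1)%:C *: b (dn p).

Let upK : cancel up dn. Proof. by case=> k j; rewrite /up /dn /= addrK. Qed.
Let dnK : cancel dn up. Proof. by case=> k j; rewrite /up /dn /= subrK. Qed.
Let rtK : cancel rt lf. Proof. by case=> k j; rewrite /rt /lf /= addrK. Qed.
Let lfK : cancel lf rt. Proof. by case=> k j; rewrite /rt /lf /= subrK. Qed.

Let b_orth p p' : '[b p, b p'] = (p == p')%:R.
Proof. by rewrite /b oe (can_eq ft). Qed.

Let b_total x : (forall p, '[x, b p] = 0) -> x = 0.
Proof. by move=> h; apply: (basis_total be) => n; rewrite -(tf n); exact: h. Qed.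

Let reindex_basis (u v : int * int -> int * int) : cancel u v -> cancel v u ->
  orthonormal_basis (fun n => e (f (u (t n)))).
Proof.
move=> uv vu.
by apply: (@basis_perm _ _ e (fun n => f (u (t n))) (fun n => f (v (t n)))) => // n;
  rewrite ft ?uv ?vu tf.
Qed.

(** A shift permutes the basis, so sharp truncation suffices here: the image of a partial sum of [x]
    is exactly a partial sum of [y] in the permuted basis. *)
Let approx (u v : int * int -> int * int) x y : cancel u v -> cancel v u ->
  (forall p, (v p).1 = p.1) ->
  (forall p, '[y, b p] = '[x, (r p.1)%:C *: b (v p)]) ->
  finite_approx b (fun p => (r p.1)%:C *: b (u p)) x y.
Proof.
move=> uv vu v1 yx.
exists (fun n => map t (index_iota 0 n)), (fun _ p => '[x, b p]); split.
  have := psum_cvg (x := x) be; rewrite /psum.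
  set g1 := (fun _ => _); set g2 := (fun _ => _); suff -> : g1 = g2 by [].
  apply/funext => n; rewrite /g1 /g2 big_map; apply: eq_bigr => i _.
  by rewrite /b tf.
have := psum_cvg (x := y) (reindex_basis uv vu); rewrite /psum.
set g1 := (fun _ => _); set g2 := (fun _ => _); suff -> : g1 = g2 by [].
apply/funext => n; rewrite /g1 /g2 big_map; apply: eq_bigr => i _.
have := yx (u (t i)); rewrite {1}/b uv => ->.
rewrite hdotZr conjc_real scalerA mulrC; congr ((_ * (r _)%:C) *: _).
by rewrite -(v1 (u (t i))) uv.
Qed.

Let shift_normal : normal_op (maxop b a').
Proof.
apply: (maxop_normal b_total (a := a)).
- move=> p p'; rewrite hdotZl hdotZr conjc_real !b_orth.
  rewrite -(can_eq dnK (up p)) upK; case: eqP => [|_]; last by rewrite !mulr0.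
  by move=> /(congr1 fst) /= <-.
- move=> p p'; rewrite !hdotZl !hdotZr !b_orth (can_eq upK) (can_eq dnK).
  by [].
- by move=> x y h; apply: (approx upK dnK).
- by move=> x y h; apply: (approx dnK upK).
Qed.

(** The vector represents the monomial z^n: on each circle only the n-th mode occurs, with the n-th
    power of the radius times the square root of the weight. *)
Lemma discrete_vectors n : exists h : H, forall p,
  '[h, b p] = (p.2 == Posz n)%:R * (Num.sqrt (qmoment q n p.1))%:C.
Proof.
have [M1 h1] := moment_pos_summable q1 n; have [M2 h2] := moment_neg_summable q1 n.
have sq k : csq (Num.sqrt (qmoment q n k))%:C = qmoment q n k.
  by rewrite csqR sqr_sqrtr // ltW // qmoment_gt0.
have [|m|m|h [hc ho]] := @two_sided_sum e (fun k => f (k, Posz n))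
    (fun k => (Num.sqrt (qmoment q n k))%:C) M1 M2 oe.
- by move=> k l /(can_inj ft)[].
- by under eq_bigr do rewrite sq.
- by under eq_bigr do rewrite sq.
exists h => -[k j] /=; case: eqP => [->|jn]; first by rewrite mul1r hc.
by rewrite mul0r ho // => l /(can_inj ft)[_].
Qed.

Lemma discrete_model : normal_model (H := H) q.
Proof.
have q0 : 0 < q by exact: lt_trans q1.
have /choice[h hP] := discrete_vectors.
have hcsq n p : csq '[h n, b p] = (p.2 == Posz n)%:R * qmoment q n p.1.
  rewrite hP csqM csqR sqr_sqrtr ?(ltW (qmoment_gt0 q1 _ _)) //.
  by case: eqP => _; rewrite ?csq0 ?mul0r // /csq /= expr1n expr0n addr0.
(* Parseval in three enumerations of the basis, chosen so that [qmomentS] relates the series term by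
   term; the shift along the first index leaves the total unchanged. *)
have h_nsq n : nsq (h n.+1) = qint q n.+1 * nsq (h n).
  have c1 := parseval (x := h n) (reindex_basis rtK lfK).
  have c2 := parseval (x := h n) be.
  have c3 := parseval (x := h n.+1) (reindex_basis upK dnK).
  pose A m := \sum_(0 <= i < m) csq '[h n, e i].
  pose B m := \sum_(0 <= i < m) csq '[h n.+1, e (f (up (t i)))].
  have c4 : (fun m => q^-1 ^+ n.+1 * (A m + (q - 1) * B m)) @ \oo -->
      q^-1 ^+ n.+1 * (nsq (h n) + (q - 1) * nsq (h n.+1)).
    apply: cvgM; first exact: cvg_cst.
    by apply: cvgD => //; apply: cvgM => //; exact: cvg_cst.
  have E : nsq (h n) = q^-1 ^+ n.+1 * (nsq (h n) + (q - 1) * nsq (h n.+1)).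
    suff G : (fun m => q^-1 ^+ n.+1 * (A m + (q - 1) * B m)) =
        (fun m => \sum_(0 <= i < m) csq '[h n, e (f (rt (t i)))]).
      by rewrite G in c4; apply: (cvg_unique _ c1 c4).
    apply/funext => m; rewrite /A /B mulr_sumr -big_split mulr_sumr /=.
    apply: eq_bigr => i _; have -> : e i = b (t i) by rewrite /b tf.
    rewrite -!/(b _) !hcsq /rt /up /=.
    have nE : Posz n.+1 = Posz n + 1 by lia.
    rewrite qmomentS // nE (inj_eq (addIr _)).
    by case: eqP => _; rewrite ?mul1r // !mul0r mulr0 addr0 mulr0.
  have q1n : q - 1 != 0 by rewrite subr_eq0 gt_eqF.
  apply: (mulfI q1n); rewrite mulrA.
  have -> : (q - 1) * qint q n.+1 = q ^+ n.+1 - 1 by rewrite subrX1.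
  have qn0 : q ^+ n.+1 != 0 by rewrite expf_neq0 // gt_eqF.
  move: E; rewrite exprVn => /(congr1 (fun w : R => q ^+ n.+1 * w)).
  by rewrite mulVKf // => E; rewrite [RHS]mulrBl mul1r E; ring.
have hgt0 n : 0 < nsq (h n).
  elim: n => [|n IH]; last by rewrite h_nsq mulr_gt0 // (qintS_gt0 (ltW q1)).
  rewrite lt_def nsq_ge0 andbT; apply/eqP => /eqP; rewrite nsq_eq0 => /eqP h0.
  have := hcsq 0%N (0, 0); rewrite h0 hdot0l csq0 /= mul1r => /eqP.
  by rewrite eq_sym gt_eqF // qmoment_gt0.
have h_orth m n : m != n -> '[h m, h n] = 0.
  move=> mn; have c0 : (fun _ : nat => 0 : H) @ \oo --> (0 : H) by exact: cvg_cst.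
  rewrite (eq_cvg_hdot (psum_cvg (x := h m) be) c0 (x' := h n) (y' := h n)) ?hdot0l // => k.
  rewrite ?hdot0l hdot_suml big1 // => i _; rewrite hdotZl (hdotC (e i)).
  rewrite -(tf i) -/(b _) !hP; case: (eqVneq (t i).2 (Posz m)) => [->|_]; last by rewrite !mul0r.
  by rewrite eqz_nat (negbTE mn) mul0r conjc0 mulr0.
pose s n := Num.sqrt (nsq (h n)).
have s0 n : s n != 0 by rewrite gt_eqF // sqrtr_gt0.
have sS n : s n.+1 = Num.sqrt (qint q n.+1) * s n.
  by rewrite /s h_nsq sqrtrM // (qint_ge0 (ltW q1)).
exists (maxop b a'), (fun n => ((s n)^-1)%:C *: h n); split; first exact: shift_normal.
  move=> m n; rewrite hdotZl hdotZr conjc_real; case: (eqVneq m n) => [->|mn].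
    rewrite -nsqE -!rmorphM -[nsq _]sqr_sqrtr ?nsq_ge0 // -/(s n).
    have -> : (s n)^-1 * ((s n)^-1 * s n ^+ 2) = 1 by field.
    by [].
  by rewrite h_orth // !mulr0.
move=> n; apply: maxopE => // p.
have r0 : Num.sqrt (qint q n.+1) != 0.
  by rewrite gt_eqF // sqrtr_gt0 (qintS_gt0 (ltW q1)).
have -> : (Num.sqrt (qint q n.+1))%:C *: (((s n.+1)^-1)%:C *: h n.+1) =
    ((s n)^-1)%:C *: h n.+1.
  by rewrite scalerA -rmorphM sS; congr ((_)%:C *: _); field; rewrite s0.
rewrite !hdotZl hdotZr conjc_real !hP /dn /=; congr (_ * _).
have nE : Posz n.+1 = Posz n + 1 by lia.
rewrite subr_eq nE.
case: eqP => _; last by rewrite !mul0r mulr0.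
by rewrite !mul1r -rmorphM qmomentSn sqrtrM // ltW // qradius_gt0.
Qed.

End DiscreteModel.

Lemma normal_model_exists (R : realType) (H : hilbertType R) (q : R) (e : nat -> H) :
  1 <= q -> orthonormal_basis e -> normal_model (H := H) q.
Proof.
rewrite le_eqVlt => /predU1P[<-|q1] be; first exact: (normal_model1 be).
have [f [t [ft tf]]] := @nat_enumeration (int * int)%type (fun n => (Posz n, 0))
  (ltac:(by move=> ? ? [])).
exact: (discrete_model q1 be ft tf).
Qed.

(** * The equivalences *)

Section Relations.
Context {R : realType} {H : hilbertType R}.
Variables (q : R) (S : operator H).
Hypothesis hq : 1 <= q.
Hypothesis S_lin : linear_operator S.
Hypothesis S_dense : densely_defined S.
Hypothesis S_closable : closable S.

Let T := closure_op S.
Let A := adj_op S.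
Let Tlin : linear_operator T. Proof. exact: closure_op_linear. Qed.
Let Alin : linear_operator A. Proof. exact: adj_op_linear. Qed.
Let Tclosed : closed_op T. Proof. exact: closure_op_closed. Qed.
Let Aclosed : closed_op A. Proof. exact: adj_op_closed. Qed.

Lemma closure_adjP x y : dom T x -> dom A y -> '[T x, y] = '[x, A y].
Proof. by rewrite /A -(adj_closure_op S_closable) => Tx Ay; apply: adj_opP. Qed.

Lemma adj_closureP x y : dom A x -> dom T y -> '[A x, y] = '[x, T y].
Proof. by move=> Ax Ty; rewrite hdotC -closure_adjP // -hdotC. Qed.

Lemma closure_adjE y z : (forall x, dom T x -> '[T x, y] = '[x, z]) ->
  dom A y /\ A y = z.
Proof.
move=> h; rewrite /A -(adj_closure_op S_closable); apply: adj_opE => //.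
exact: closure_op_dense.
Qed.

(** The relation is applied to [g], both operators being moved off [f], so [f] ranges over the whole
    common domain. *)
Lemma Oq_dom_form D f g : Oq_dom q S D -> dom T f -> dom A f -> D g ->
  '[T f, T g] - q%:C * '[A f, A g] = '[f, g].
Proof.
move=> [_ _ _ DD Dq] Tf Af Dg.
have [[Tg ATg] [Ag TAg]] := DD _ Dg.
have /= Dqg := Dq _ Dg.
rewrite closure_adjP // adj_closureP // -[in RHS]Dqg hdotBr hdotZr.
by rewrite conjc_real.
Qed.

Lemma Oq_form_nsq f : '[T f, T f] - q%:C * '[A f, A f] = '[f, f] ->
  nsq (T f) = q * nsq (A f) + nsq f.
Proof.
rewrite -!nsqE -rmorphM -rmorphB /= => /complexI <-; ring.
Qed.

Lemma Oq_dom_nsq D f : Oq_dom q S D -> D f -> nsq (T f) = q * nsq (A f) + nsq f.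
Proof.
move=> Oq Df; apply: Oq_form_nsq; apply: (Oq_dom_form Oq) => //.
  by case: Oq => _ _ _ /(_ _ Df)[[]].
by case: Oq => _ _ _ /(_ _ Df)[_ []].
Qed.

Lemma Oq_dom_nsqB D f g : Oq_dom q S D -> D f -> D g ->
  nsq (T f - T g) = q * nsq (A f - A g) + nsq (f - g).
Proof.
move=> Oq Df Dg; have [_ Ds _ DD _] := Oq.
have [[Tf _] [Af _]] := DD _ Df; have [[Tg _] [Ag _]] := DD _ Dg.
have [_ <-] := linear_operatorB Tlin Tf Tg; have [_ <-] := linear_operatorB Alin Af Ag.
by apply: (Oq_dom_nsq Oq); exact: linear_subspaceB.
Qed.

Lemma core_adj_limit D x : Oq_dom q S D -> core S D -> dom T x ->
  dom A x /\ exists u, [/\ forall n, D (u n), u @ \oo --> x,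
    (fun n => T (u n)) @ \oo --> T x & (fun n => A (u n)) @ \oo --> A x].
Proof.
move=> Oq cD Tx; have [_ Ds _ DD _] := Oq.
have [_ DT /(_ _ Tx)[u [Du ux uTx]]] := (coreP _ S_closable).1 cD.
have Au n : dom A (u n) by have [_ []] := DD _ (Du n).
have [y uAy] : exists y : H, (fun n => A (u n)) @ \oo --> y.
  apply: (@cvg_dominated _ _ _ _ (cvg_nsq_cauchy uTx) 1) => m n.
  rewrite mul1r (Oq_dom_nsqB Oq) //.
  have := nsq_ge0 (u m - u n); have := nsq_ge0 (A (u m) - A (u n)).
  by move: hq; nra.
have [Ax Axy] := Aclosed Au ux uAy.
by split=> //; exists u; split=> //; rewrite Axy.
Qed.

Lemma adj_core_limit D x : Oq_dom q S D -> core A D -> dom A x -> dom T x.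
Proof.
move=> Oq cD Ax; have [_ Ds _ DD _] := Oq.
have cA := closed_op_closable Aclosed.
have [_ DA h] := (coreP _ cA).1 cD.
have [|u [Du ux uAx]] := h x; first by rewrite closed_op_dom_closure.
have Au n : dom A (u n) by have [_ []] := DD _ (Du n).
have Tu n : dom T (u n) by have [[]] := DD _ (Du n).
have {}uAx : (fun n => A (u n)) @ \oo --> A x.
  move: uAx; rewrite closed_op_closureE //.
  suff -> : (fun n => closure_op A (u n)) = (fun n => A (u n)) by [].
  by apply/funext => n; rewrite closed_op_closureE.
have [y uTy] : exists y : H, (fun n => T (u n)) @ \oo --> y.
  apply: nsq_complete => e e0; have q2 : 0 < 2 * q by move: hq; lra.
  have [N1 hN1] := cvg_nsq_cauchy uAx (divr_gt0 e0 q2).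
  have [N2 hN2] := cvg_nsq_cauchy ux (divr_gt0 e0 (ltr0n _ 2)).
  exists (maxn N1 N2) => m n; rewrite !geq_max => /andP[m1 m2] /andP[n1 n2].
  rewrite (Oq_dom_nsqB Oq) //; have := hN1 _ _ m1 n1; have := hN2 _ _ m2 n2.
  by rewrite (ltr_pdivlMr _ _ q2); lra.
by have [] := Tclosed Tu ux uTy.
Qed.

Lemma cond_ii_iii : cond_ii q S -> cond_iii q S.
Proof.
move=> [irr [D [Oq _ _ cD]] _ [K [J [N [[_ nN _] tN sN]]]]].
have [_ Ds _ DD _] := Oq.
(* Both domains are preimages under [J] of the domain shared by [N] and its adjoint. *)
have domTA : dom T = dom A.
  rewrite /T /A tN -sN closed_op_dom_closure; last exact: normal_op_closed.
  by case: nN => _ _ ->.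
split=> //; exists D; split=> //.
apply/(coreP _ (closed_op_closable Aclosed)); split=> //.
  by move=> x /DD[_ [Ax _]]; rewrite closed_op_dom_closure.
move=> x; rewrite closed_op_dom_closure // => Ax.
have [|_ [u [Du ux _ uAx]]] := core_adj_limit Oq cD (x := x); first by rewrite domTA.
exists u; split=> //; rewrite closed_op_closureE //.
suff -> : (fun n => closure_op A (u n)) = (fun n => A (u n)) by [].
by apply/funext => n; rewrite closed_op_closureE //; have [_ []] := DD _ (Du n).
Qed.

Lemma cond_iii_iv : cond_iii q S -> cond_iv q S.
Proof.
move=> [irr [D [Oq cD cAD]]].
have domTA : dom T = dom A.
  apply/seteqP; split=> x; first by move=> Tx; have [] := core_adj_limit Oq cD Tx.
  by move=> Ax; exact: (adj_core_limit Oq cAD Ax).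
split=> //; rewrite /Oq_weak (adj_closure_op S_closable) => f g [Tf Af] [Tg Ag].
(* [Oq_dom_form] wants its second argument in [D]; approximating [g] in both graph norms at once
   passes to the common domain. *)
have [_ [u [Du ug uTg uAg]]] := core_adj_limit Oq cD Tg.
have h1 := cvg_scal_lin (c := - q%:C) (cvg_hdotr (y := A f) uAg) (cvg_hdotr (y := T f) uTg).
have h2 := cvg_hdotr (y := f) ug.
rewrite addrC -mulNr; apply: eq_cvg_scal h1 _.
suff -> : (fun n => - q%:C * '[A f, A (u n)] + '[T f, T (u n)] : R[i]^o) =
  (fun n => '[f, u n]) by [].
by apply/funext => n; rewrite -(Oq_dom_form Oq Tf Af (Du n)) mulNr addrC.
Qed.

(** The lower bound makes the range closed, and its orthogonal complement is the kernel of the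
    adjoint. *)
Lemma closed_range_onto : (forall x, dom T x -> nsq x <= nsq (T x)) ->
  ker_op A = [set 0] -> forall y, exists2 x, dom T x & T x = y.
Proof.
move=> bT kA y; pose Q := [set T x | x in dom T].
have [[T0 TD] TL] := Tlin.
have Qs : linear_subspace Q.
  split; first by exists 0 => //; rewrite linear_operator0.
  move=> a _ _ [x1 d1 <-] [x2 d2 <-]; exists (a *: x1 + x2); first exact: TD.
  exact: TL.
have : closure Q y.
  rewrite orth_total_closure // => z Qz.
  have [Az Az0] : dom A z /\ A z = 0.
    by apply: closure_adjE => x Tx; rewrite hdot0r; apply: Qz; exists x.
  by have : ker_op A z; [split | rewrite kA].
move=> /closure_seqP[v Qv vy].
have /choice[u hu] : forall n, exists x, dom T x /\ T x = v n.
  by move=> n; have [x] := Qv n; exists x.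
have Tu n : dom T (u n) by case: (hu n).
have Tuv : (fun n => T (u n)) = v by apply/funext => n; case: (hu n).
have [x ux] : exists x : H, u @ \oo --> x.
  apply: (@cvg_dominated _ _ _ _ (cvg_nsq_cauchy vy) 1) => m n.
  rewrite mul1r -Tuv; have [d <-] := linear_operatorB Tlin (Tu m) (Tu n).
  exact: bT.
have [|d e] := Tclosed Tu ux (y := y); first by rewrite Tuv.
by exists x.
Qed.

Lemma weak_nsq f : Oq_weak q T -> dom T f -> dom A f ->
  nsq (T f) = q * nsq (A f) + nsq f.
Proof.
rewrite /Oq_weak (adj_closure_op S_closable) => w Tf Af.
have := w f f (conj Tf Af) (conj Tf Af).
by rewrite -!nsqE -rmorphM -rmorphB /= => /complexI <-; ring.
Qed.

Lemma weak_ker_adj : (exists x : H, x != 0) -> Oq_weak q T -> dom T = dom A ->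
  ker_op A <> [set 0].
Proof.
move=> hH w domTA kA.
have q0 : 0 <= q by rewrite (le_trans ler01).
have onto : forall y, exists2 x, dom T x & T x = y.
  apply: closed_range_onto => // x Tx; rewrite weak_nsq // -?domTA //.
  by rewrite lerDr mulr_ge0 // nsq_ge0.
have lower n : forall f, dom T f -> n%:R * nsq f <= nsq (T f).
  elim: n => [|n IH] f Tf; first by rewrite mul0r nsq_ge0.
  have [g Tg gf] := onto f; have Af : dom A f by rewrite -domTA.
  rewrite weak_nsq //; have := IH _ Tg; rewrite gf => hg.
  (* With f = T g, |f|^4 = |<g, A f>|^2 <= |g|^2 |A f|^2, while the induction hypothesis at [g]
     reads n |g|^2 <= |f|^2. Together they bound |A f|^2 below by n |f|^2. *)
  have := cauchy_schwarz g (A f); rewrite -closure_adjP // gf -nsqE csqR => cs.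
  have [f0|f0] := eqVneq (nsq f) 0.
    by rewrite f0 mulr0 addr0 mulr_ge0 // nsq_ge0.
  have fp : 0 < nsq f by rewrite lt_def f0 nsq_ge0.
  have h : n%:R * nsq f <= nsq (A f).
    rewrite -(ler_pM2l fp).
    have : n%:R * nsq f ^+ 2 <= n%:R * (nsq g * nsq (A f)) by rewrite ler_wpM2l ?ler0n.
    have : n%:R * nsq g * nsq (A f) <= nsq f * nsq (A f) by rewrite ler_wpM2r ?nsq_ge0.
    rewrite expr2; lra.
  have : nsq (A f) <= q * nsq (A f) by rewrite ler_peMl ?nsq_ge0.
  rewrite -natr1 mulrDl mul1r; lra.
have [f Tf f0] := dense_nonzero hH (closure_op_dense S_dense S_closable).
have fp : 0 < nsq f by rewrite lt_def nsq_eq0 f0 nsq_ge0.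
have := lower (Num.truncn (nsq (T f) / nsq f)).+1 _ Tf.
rewrite -ler_pdivlMr // leNgt => /negP; apply.
exact: truncnS_gt.
Qed.

Lemma cond_iv_v : (exists x : H, x != 0) -> cond_iv q S -> cond_v q S.
Proof.
move=> hH [irr w domTA]; split=> //.
- rewrite -domTA setIid; exact: closure_op_dense.
- exact: weak_ker_adj.
(* Since the domains agree, the weak relation can be tested against every [x] in [dom T]; this is
   what puts [T h] into [dom A]. *)
have step h : dom T h -> dom T (A h) ->
    dom A (T h) /\ A (T h) = q%:C *: T (A h) + h.
  move=> Th TAh; apply: closure_adjE => x Tx.
  have Ah : dom A h by rewrite -domTA.
  have Ax : dom A x by rewrite -domTA.
  have := w x h; rewrite (adj_closure_op S_closable) => /(_ (conj Tx Ax) (conj Th Ah)).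
  rewrite adj_closureP // => /eqP; rewrite subr_eq => /eqP ->.
  by rewrite hdotDr hdotZr conjc_real addrC.
move=> n f [Af Af']; have Af0 : A f = 0 by [].
suff : [/\ dom (pow_op T n) f, dom T (pow_op T n f), dom T (A (pow_op T n f)) &
   T (A (pow_op T n f)) = (qint q n)%:C *: pow_op T n f].
  by case=> d1 d2 _ _; split=> //; split=> //; rewrite -domTA.
elim: n => [|n [d1 d2 d3 e]].
  have -> : pow_op T 0 f = f by [].
  rewrite Af0 qint0 scale0r linear_operator0 //; split=> //; first by rewrite domTA.
  by case: Tlin => -[].
have [d4 e4] := step _ d2 d3.
have e5 : A (T (pow_op T n f)) = (qint q n.+1)%:C *: pow_op T n f.
  by rewrite e4 e scalerA -rmorphM -[X in _ + X]scale1r -scalerDl -rmorphD qintS addrC.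
have [d6 e6] := linear_operatorZ (qint q n.+1)%:C Tlin d2.
have E : pow_op T n.+1 f = T (pow_op T n f) by [].
by split; rewrite ?E ?e5 // domTA.
Qed.

(** At n = 0 the truncated index [n.-1] is harmless: its coefficient comes from [0]_q = 0, so [e 0]
    is a vacuum. Totality of [e] is left open, as it comes from irreducibility. *)
Definition ladder (e : nat -> H) :=
  [/\ orthonormal_seq e,
      forall n, dom T (e n),
      forall n, T (e n) = (Num.sqrt (qint q n.+1))%:C *: e n.+1,
      forall n, dom A (e n) &
      forall n, A (e n) = (Num.sqrt (qint q n))%:C *: e n.-1].

(** As [A (e 0) = 0], the coefficient of [y] at 0 vanishes, which accounts for the length [n.+1].
    The vector [y] is only a weak image, because tightness applies this to an [x] not yet known to
    lie in [dom T]. *)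
Lemma ladder_weak_psum e x y n : ladder e ->
  (forall m, '[y, e m] = '[x, A (e m)]) ->
  dom T (psum e x n) /\ T (psum e x n) = psum e y n.+1.
Proof.
move=> [oe Te TE Ae AE] yx.
have [d E] := linear_operator_sum (index_iota 0 n) (fun i => '[x, e i]) Tlin Te.
split=> //; rewrite /psum E big_nat_recl // yx AE qint0 sqrtr0 scale0r.
rewrite hdot0r scale0r add0r; apply: eq_bigr => i _.
by rewrite yx AE TE hdotZr conjc_real scalerA mulrC.
Qed.

Lemma ladder_psum e x n : ladder e -> dom T x ->
  dom T (psum e x n) /\ T (psum e x n) = psum e (T x) n.+1.
Proof.
move=> le Tx; apply: ladder_weak_psum => // m.
by apply: closure_adjP => //; case: le.
Qed.

Lemma ladder_reduces e : ladder e -> reduces (closure (seq_span e)) T.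
Proof.
move=> le; have [oe _ _ _ _] := le.
set L := closure _; have Ls : linear_subspace L.
  by apply: linear_subspace_closure; exact: linear_seq_span.
have Lc : closed L by exact: closed_closure.
(* Partial sums see only the component in [L], hence converge to the projection even when [x] is
   outside [L]. *)
have pP x : psum e x @ \oo --> oproj L x.
  have [LP xP] := oprojP x Ls Lc.
  suff -> : psum e x = psum e (oproj L x) by exact: psum_closure.
  apply/funext => n; apply: eq_bigr => i _; congr (_ *: _).
  apply/eqP; rewrite -subr_eq0 -hdotBl xP //.
  by apply: subset_closure; exact: seq_span_basis.
have h x : dom T x -> dom T (oproj L x) /\ T (oproj L x) = oproj L (T x).
  move=> Tx; apply: (Tclosed (u := psum e x)) => //.
    by move=> n; have [] := ladder_psum n le Tx.
  have -> : (fun n => T (psum e x n)) = (fun n => psum e (T x) (n + 1)%N).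
    by apply/funext => n; have [_ ->] := ladder_psum n le Tx; rewrite addn1.
  by rewrite (cvg_shiftn 1 (psum e (T x))).
split=> x [/= Tx _]; first by split=> //; exact: (h x Tx).1.
exact: (esym (h x Tx).2).
Qed.

Lemma ladder_core e : ladder e -> orthonormal_basis e -> core S (seq_span e).
Proof.
move=> le be; have [oe Te _ _ _] := le.
apply/(coreP _ S_closable); split; first exact: linear_seq_span.
  by apply: seq_span_sub => //; case: Tlin.
move=> x Tx; exists (psum e x); split; first by move=> n; exact: psum_in_span.
  exact: psum_cvg.
have -> : (fun n => closure_op S (psum e x n)) = (fun n => psum e (T x) (n + 1)%N).
  by apply/funext => n; have [_ ->] := ladder_psum n le Tx; rewrite addn1.
by rewrite (cvg_shiftn 1 (psum e (T x))); exact: psum_cvg.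
Qed.

(** * From (v): the normalised orbit of a vacuum vector is a ladder *)

Section OrbitOfVacuum.
Variable f : H.
Hypothesis w : Oq_weak q T.
Hypothesis TA_dense : dense (dom T `&` dom A).
Hypothesis f_ker : ker_op A f.
Hypothesis f0 : f != 0.
Hypothesis f_dom : forall n, (dom T `&` dom A) (pow_op T n f).

Let h n := pow_op T n f.
Let Th n : dom T (h n). Proof. by case: (f_dom n). Qed.
Let Ah n : dom A (h n). Proof. by case: (f_dom n). Qed.
Let hS n : h n.+1 = T (h n). Proof. by []. Qed.

Lemma orbit_adj n : A (h n) = (qint q n)%:C *: h n.-1.
Proof.
elim: n => [|n IH]; first by rewrite qint0 scale0r; case: f_ker.
(* The weak relation is available only against the common domain, whose density is enough; there it
   produces the recursion [n+1]_q = 1 + q [n]_q. *)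
apply: (dense_orth TA_dense) => g [Tg Ag].
rewrite hdotC (hdotC g) hS; congr (_^*)%C.
rewrite adj_closureP //; last by rewrite -hS.
have := w; rewrite /Oq_weak (adj_closure_op S_closable).
move=> /(_ _ _ (conj (Th n) (Ah n)) (conj Tg Ag)) /eqP.
rewrite subr_eq => /eqP ->; rewrite IH !hdotZl qintS rmorphD rmorphM mulrDl mul1r -mulrA.
congr (_ + _ * _); case: n {IH} => [|n]; first by rewrite qint0 !mul0r.
by rewrite hS /= -closure_adjP // -hS.
Qed.

Lemma orbit_nsq n : nsq (h n.+1) = qint q n.+1 * nsq (h n).
Proof.
apply: complexI; rewrite rmorphM /= !nsqE {1}hS closure_adjP // orbit_adj hdotZr.
by rewrite conjc_real.
Qed.

Lemma orbit_nsq_gt0 n : 0 < nsq (h n).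
Proof.
elim: n => [|n IH]; last by rewrite orbit_nsq mulr_gt0 // (qintS_gt0 hq).
by rewrite lt_def nsq_eq0 f0 nsq_ge0.
Qed.

Lemma orbit_orth m n : (m < n)%N -> '[h m, h n] = 0.
Proof.
elim: m n => [|m IH] [|n] // mn; rewrite (hS n) -adj_closureP // orbit_adj hdotZl.
  by rewrite qint0 mul0r.
by rewrite IH ?mulr0.
Qed.

Lemma orbit_ladder : exists e, ladder e.
Proof.
pose s n := Num.sqrt (nsq (h n)).
have s0 n : s n != 0 by rewrite gt_eqF // sqrtr_gt0 orbit_nsq_gt0.
have sS n : s n.+1 = Num.sqrt (qint q n.+1) * s n.
  by rewrite /s orbit_nsq sqrtrM // (qint_ge0 hq).
exists (fun n => ((s n)^-1)%:C *: h n); split.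
- move=> m n; rewrite hdotZl hdotZr conjc_real.
  case: (ltngtP m n) => [mn|nm|->].
  + by rewrite orbit_orth // !mulr0.
  + by rewrite hdotC orbit_orth // conjc0 !mulr0.
  + rewrite -nsqE -!rmorphM -[nsq _]sqr_sqrtr ?nsq_ge0 // -/(s n).
    have -> : (s n)^-1 * ((s n)^-1 * s n ^+ 2) = 1 by field.
    by [].
- by move=> n; have [] := linear_operatorZ ((s n)^-1)%:C Tlin (Th n).
- move=> n; have [_ ->] := linear_operatorZ ((s n)^-1)%:C Tlin (Th n).
  rewrite -hS scalerA -rmorphM sS; congr ((_)%:C *: _); field.
  by rewrite s0 /= gt_eqF // sqrtr_gt0 (qintS_gt0 hq).
- by move=> n; have [] := linear_operatorZ ((s n)^-1)%:C Alin (Ah n).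
- move=> n; have [_ ->] := linear_operatorZ ((s n)^-1)%:C Alin (Ah n).
  rewrite orbit_adj; case: n => [|n].
    by rewrite qint0 sqrtr0 !scale0r scaler0.
  have r0 : Num.sqrt (qint q n.+1) != 0 by rewrite gt_eqF // sqrtr_gt0 (qintS_gt0 hq).
  have r2 : qint q n.+1 = Num.sqrt (qint q n.+1) ^+ 2 by rewrite sqr_sqrtr // (qint_ge0 hq).
  rewrite !scalerA -!rmorphM sS; move: r0 r2; set r := Num.sqrt _ => r0 ->.
  by congr ((_)%:C *: _); field; rewrite s0.
Qed.

End OrbitOfVacuum.

Lemma cond_v_i : cond_v q S -> cond_i q S.
Proof.
move=> [irr w dTA kA hk].
have [f fk f0] : exists2 f, ker_op A f & f != 0.
  apply: contrapT => nf; apply: kA; apply/seteqP; split=> x.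
    move=> kx; apply/eqP; apply: contrapT => /negP x0; apply: nf.
    by exists x.
  move=> ->; split; last exact: linear_operator0.
  by case: Alin => -[].
have [e le] := orbit_ladder w dTA fk f0 (fun n => (hk n f fk).2).
have [oe Te TE Ae AE] := le.
have Ls : linear_subspace (closure (seq_span e)).
  by apply: linear_subspace_closure; exact: linear_seq_span.
have be : orthonormal_basis e.
  (* The trivial subspace is excluded, since it would contain the unit vector [e 0]. *)
  split=> //; have [L0|//] := irr _ Ls (@closed_closure _ _) (ladder_reduces le).
  have : closure (seq_span e) (e 0%N) by apply: subset_closure; exact: seq_span_basis.
  rewrite L0 => e0; have := oe 0%N 0%N; rewrite e0 hdot0l => /eqP.
  by rewrite eq_sym oner_eq0.
split; first exact: basis_separable be.
by exists e; split=> //; exact: ladder_core.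
Qed.

(** * From (i): the q-creation operator in its basis *)

Section CreationBasis.
Variable e : nat -> H.
Hypothesis be : orthonormal_basis e.
Hypothesis Te : forall n, dom T (e n).
Hypothesis TE : forall n, T (e n) = (Num.sqrt (qint q n.+1))%:C *: e n.+1.
Hypothesis cD : core S (seq_span e).

Let D := seq_span e.
Let oe : orthonormal_seq e. Proof. by case: be. Qed.
Let Ds : linear_subspace D. Proof. exact: linear_seq_span. Qed.

(** The relations at the [e n] determine [T] on the span only; the core hypothesis carries the
    pairing identity to all of [dom T]. *)
Lemma creation_adj n : dom A (e n) /\ A (e n) = (Num.sqrt (qint q n))%:C *: e n.-1.
Proof.
apply: closure_adjE => // x Tx.
have [_ _ /(_ _ Tx)[u [Du ux uTx]]] := (coreP _ S_closable).1 cD.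
apply: (eq_cvg_hdot uTx ux) => k.
have /seq_spanP[N [c ->]] := Du k.
have [_ ->] := linear_operator_sum (index_iota 0 N) c Tlin Te.
rewrite !hdot_suml; apply: eq_bigr => i _; rewrite !hdotZl -/T TE; congr (_ * _).
rewrite hdotZl hdotZr conjc_real !oe; case: n => [|n].
  by rewrite qint0 sqrtr0 mul0r mulr0.
by rewrite eqSS; case: eqP => [->|] //; rewrite !mulr0.
Qed.

Let le : ladder e.
Proof. by split=> //; move=> n; have [] := creation_adj n. Qed.

Let Ae n : dom A (e n). Proof. by have [] := creation_adj n. Qed.
Let AE n : A (e n) = (Num.sqrt (qint q n))%:C *: e n.-1.
Proof. by have [] := creation_adj n. Qed.
Let r_neq0 n : (Num.sqrt (qint q n.+1))%:C != 0 :> R[i].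
Proof. by rewrite eq_complex /= eqxx andbT gt_eqF // sqrtr_gt0 (qintS_gt0 hq). Qed.

Lemma creation_irreducible : irreducible_op T.
Proof.
move=> L Ls Lc [LT1 LT2].
have PT x : dom T x -> dom T (oproj L x) /\ oproj L (T x) = T (oproj L x).
  by move=> Tx; have [_ h] := LT1 x (conj Tx I); split=> //; exact: (LT2 x (conj Tx I)).
have Lp x : L (oproj L x) by have [] := oprojP x Ls Lc.
have xp x z : L z -> '[x - oproj L x, z] = 0 by have [_] := oprojP x Ls Lc; apply.
have Pid x : L x -> oproj L x = x.
  by move=> Lx; apply: oproj_eq => // z _; rewrite subrr hdot0l.
have Psa x y : '[oproj L x, y] = '[x, oproj L y].
  have h1 : '[oproj L x, y - oproj L y] = 0 by rewrite hdotC xp ?conjc0.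
  have h2 := xp x _ (Lp y).
  move/eqP: h1; rewrite hdotBr subr_eq0 => /eqP ->.
  by move/eqP: h2; rewrite hdotBl subr_eq0 => /eqP ->.
(* For the projection P, <P e_0, T e_n> = <e_0, T P e_n> = <A e_0, P e_n> = 0, so P e_0 is
   orthogonal to every e_(n+1). *)
have P0 : oproj L (e 0%N) = '[oproj L (e 0%N), e 0%N] *: e 0%N.
  apply: (basis_eq be) => -[|n]; first by rewrite hdotZl oe eqxx mulr1.
  rewrite hdotZl oe mulr0; apply: (mulfI (r_neq0 n)).
  rewrite mulr0 -[X in X * _]conjc_real -hdotZr -TE Psa (PT _ (Te n)).2.
  rewrite hdotC closure_adjP ?AE ?qint0 ?sqrtr0 ?scale0r ?hdot0r ?conjc0 //.
  exact: (PT _ (Te n)).1.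
(* If the coefficient vanishes, T propagates P e_0 = 0 up the ladder and [L] is trivial; otherwise
   [L] contains [e 0], hence every [e n]. *)
have [c0|c0] := eqVneq '[oproj L (e 0%N), e 0%N] 0.
  left; rewrite c0 scale0r in P0.
  have Pn n : oproj L (e n) = 0.
    elim: n => [//|n IH]; apply: oproj_eq => //; first by case: Ls.
    move=> z Lz; rewrite subr0; apply: (mulfI (r_neq0 n)); rewrite mulr0 -hdotZl -TE.
    have := xp (T (e n)) z Lz; rewrite (PT _ (Te n)).2 IH linear_operator0 //.
    by rewrite subr0.
  apply/seteqP; split=> x; last by move=> ->; case: Ls.
  by move=> Lx; apply: (basis_total be) => n; rewrite -(Pid x Lx) Psa Pn hdot0r.
right.
have Ln n : L (e n).
  elim: n => [|n IH].
    have -> : e 0%N = '[oproj L (e 0%N), e 0%N]^-1 *: oproj L (e 0%N).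
      by rewrite [in X in _ *: X]P0 scalerA mulVf // scale1r.
    exact: linear_subspaceZ.
  have -> : e n.+1 = ((Num.sqrt (qint q n.+1))%:C)^-1 *: T (e n).
    by rewrite TE scalerA mulVf // scale1r.
  by apply: linear_subspaceZ => //; rewrite -[e n]Pid // -(PT _ (Te n)).2.
apply/seteqP; split=> // x _; move/closure_id: Lc => ->.
by apply: (closure_subset (seq_span_sub Ls Ln)); have [_ ->] := be.
Qed.

Lemma span_in_domT : D `<=` dom T.
Proof. by apply: seq_span_sub => //; case: Tlin. Qed.

Lemma span_in_domA : D `<=` dom A.
Proof. by apply: seq_span_sub => //; case: Alin. Qed.

Lemma invariant_span (B : operator H) : linear_operator B ->
  (forall n, dom B (e n) /\ D (B (e n))) -> Defs.invariant B D.
Proof.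
move=> Bl Be; have [Bd BL] := Bl.
have h : D `<=` [set x | dom B x /\ D (B x)].
  apply: seq_span_sub; last exact: Be.
  split; first by split; [case: Bd | rewrite linear_operator0 //; case: Ds].
  move=> a x y [Bx DBx] [By DBy]; split; first by case: Bd => _; apply.
  by rewrite BL //; case: Ds => _; apply.
split=> //; first by move=> x /h[].
by move=> _ [x /h[_ DBx] <-].
Qed.

Lemma creation_invT : Defs.invariant T D.
Proof.
apply: invariant_span => // n; split=> //; rewrite TE.
by apply: linear_subspaceZ => //; exact: seq_span_basis.
Qed.

Lemma creation_invA : Defs.invariant A D.
Proof.
apply: invariant_span => // n; split=> //; rewrite AE.
by apply: linear_subspaceZ => //; exact: seq_span_basis.
Qed.

Lemma creation_Oq : Oq_dom q S D.
Proof.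
have [_ _ TD] := creation_invT; have [_ _ AD] := creation_invA.
have DTA f : D f -> dom A (T f) by move=> Df; apply: span_in_domA; apply: TD; exists f.
have DAT f : D f -> dom T (A f) by move=> Df; apply: span_in_domT; apply: AD; exists f.
have [_ TL] := Tlin; have [_ AL] := Alin.
have h : D `<=` [set f | D f /\ A (T f) - q%:C *: T (A f) = f].
  apply: seq_span_sub.
    split.
      split; first by case: Ds.
      by rewrite !linear_operator0 // scaler0 subr0.
    move=> a f g [Df f1] [Dg g1]; split; first by case: Ds => _; apply.
    have Tf := span_in_domT Df; have Tg := span_in_domT Dg.
    have Af := span_in_domA Df; have Ag := span_in_domA Dg.
    rewrite TL // AL; [|exact: DTA|exact: DTA].
    rewrite AL // TL; [|exact: DAT|exact: DAT].
    rewrite -[in RHS]f1 -[in RHS]g1 !scalerBr scalerDr !scalerA opprD (mulrC q%:C).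
    by rewrite addrACA.
  move=> n; split; first exact: seq_span_basis.
  have s2 m : (Num.sqrt (qint q m))%:C * (Num.sqrt (qint q m))%:C = (qint q m)%:C.
    by rewrite -rmorphM -expr2 sqr_sqrtr // qint_ge0.
  have ATe : A (T (e n)) = (qint q n.+1)%:C *: e n.
    have [_] := linear_operatorZ (Num.sqrt (qint q n.+1))%:C Alin (Ae n.+1).
    by rewrite -TE AE scalerA s2.
  have TAe : T (A (e n)) = (qint q n)%:C *: e n.
    have [_] := linear_operatorZ (Num.sqrt (qint q n))%:C Tlin (Te n.-1).
    rewrite -AE TE => ->; case: n {ATe} => [|n]; last by rewrite scalerA s2.
    by rewrite qint0 sqrtr0 !scale0r.
  rewrite ATe TAe scalerA -scalerBl -rmorphM -rmorphB qintS addrK.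
  by rewrite scale1r.
split=> //; first by apply/denseE; case: be.
  by move=> f Df; split; split; [exact: span_in_domT|exact: DTA|exact: span_in_domA|exact: DAT].
by move=> f /h[].
Qed.

(** [A] annihilates the vacuum term and sends the partial sum of length n + 1 of [x] to that of
    length n of [A x]. *)
Lemma creation_core_adj : core A D.
Proof.
have cA := closed_op_closable Aclosed.
apply/(coreP _ cA); split=> //; first by rewrite closed_op_dom_closure //; exact: span_in_domA.
move=> x; rewrite closed_op_dom_closure // => Ax.
exists (fun n => psum e x (n + 1)%N); split.
- by move=> n; exact: psum_in_span.
- by rewrite (cvg_shiftn 1 (psum e x)); exact: psum_cvg.
rewrite closed_op_closureE //.
have -> : (fun n => closure_op A (psum e x (n + 1)%N)) = psum e (A x); last exact: psum_cvg.
apply/funext => n; rewrite addn1 closed_op_closureE //; last first.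
  by apply: span_in_domA; exact: psum_in_span.
have [_ ->] := linear_operator_sum (index_iota 0 n.+1) (fun i => '[x, e i]) Alin Ae.
rewrite big_nat_recl // AE qint0 sqrtr0 scale0r scaler0 add0r.
apply: eq_bigr => i _.
by rewrite adj_closureP // TE hdotZr conjc_real AE scalerA mulrC.
Qed.

Lemma creation_dom_eq : dom T = dom A.
Proof.
apply/seteqP; split=> x xd.
  by have [] := core_adj_limit creation_Oq cD xd.
exact: (adj_core_limit creation_Oq creation_core_adj xd).
Qed.

(** The images of the partial sums of [x] are partial sums of [y], and [T] is closed. *)
Lemma creation_dom_weak x y : (forall m, '[y, e m] = '[x, A (e m)]) -> dom T x.
Proof.
move=> yx; have [] := Tclosed (u := psum e x) (x := x) (y := y) => //.
- by move=> n; have [] := ladder_weak_psum n le yx.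
- exact: psum_cvg.
have -> : (fun n => T (psum e x n)) = (fun n => psum e y (n + 1)%N).
  apply/funext => n; rewrite addn1.
  by have [] := ladder_weak_psum n le yx.
by rewrite (cvg_shiftn 1 (psum e y)); exact: psum_cvg.
Qed.

Lemma creation_extension : exists (J : {linear H -> H}) (N : operator H),
  [/\ normal_extension S J N, tight S J N & star_tight S J N].
Proof.
have [N [g [nN og Ng]]] := normal_model_exists hq be.
have [J [Jdot Je]] := isometry_exists be og.
have cN := normal_op_closed nN; have [Nl _ NA _] := nN.
have Jcvg (u : nat -> H) x : u @ \oo --> x -> (fun n => J (u n)) @ \oo --> J x.
  move=> /cvg_nsqP ux; apply/cvg_nsqP => ep /ux; apply: filterS => n.
  by rewrite -linearB /nsq Jdot.
have NJe n : dom N (J (e n)) /\ N (J (e n)) = J (T (e n)).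
  by rewrite Je TE linearZ /= Je; exact: Ng.
have ND : D `<=` [set x | dom T x /\ dom N (J x) /\ N (J x) = J (T x)].
  have [Nd NL] := Nl; have [Td TL] := Tlin.
  apply: seq_span_sub => [|n]; last by split.
  have J0 : J 0 = 0 by exact: raddf0.
  split.
    split; first by case: Td.
    by rewrite J0 !linear_operator0 // J0; split=> //; case: Nd.
  move=> c x y [Tx [NJx Ex]] [Ty [NJy Ey]]; split; first by case: Td => _; apply.
  rewrite linearP; split; first by case: Nd => _; apply.
  by rewrite NL // TL // Ex Ey linearP.
have NJ x : dom T x -> dom N (J x) /\ N (J x) = J (T x).
  move=> Tx; have [_ _ /(_ _ Tx)[u [Du ux uTx]]] := (coreP _ S_closable).1 cD.
  apply: (cN (fun n => J (u n))) => //.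
  - by move=> n; have [_ []] := ND _ (Du n).
  - exact: Jcvg.
  - have -> : (fun n => N (J (u n))) = (fun n => J (T (u n))).
      by apply/funext => n; have [_ []] := ND _ (Du n).
    exact: Jcvg.
have tJ : dom T = J @^-1` dom N.
  apply/seteqP; split=> x; first by move=> /NJ[].
  move=> /= NJx.
  (* [y] is the compression of [N (J x)] to [H], given by its coefficients. Moving [N] to the other
     side, where its adjoint compresses to [A] on the basis, shows that [y] is a weak image of
     [x]. *)
  have [n|y _ hy] := @riesz_fischer _ _ e (fun m => '[N (J x), g m]) (nsq (N (J x))) oe.
    by rewrite (bessel og) ?iota_uniq.
  apply: (creation_dom_weak (y := y)) => m; rewrite hy -Je.
  have dm : dom (adj_op N) (J (e m)) by rewrite -NA; case: (NJe m).
  rewrite adj_opP //.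
  apply: (eq_cvg_hdot (Jcvg _ _ (psum_cvg (x := x) be)) (psum_cvg (x := x) be)) => n.
  rewrite linear_sum !hdot_suml; apply: eq_bigr => i _ /=.
  rewrite linearZ !hdotZl; congr (_ * _).
  have [d E] := NJe i; rewrite -adj_opP // E Jdot; exact: closure_adjP.
exists J, N; split.
- split=> // x Sx; have [Tx E] := closure_op_extends S_closable Sx.
  by have [d ->] := NJ x Tx; rewrite -E.
- by rewrite /tight (closed_op_dom_closure cN).
- by rewrite /star_tight -NA -tJ creation_dom_eq.
Qed.

End CreationBasis.

Lemma cond_i_ii : cond_i q S -> cond_ii q S.
Proof.
move=> [_ [e [be Te TE cD]]].
have [J [N ext]] := creation_extension be Te TE cD.
split.
- exact: creation_irreducible be Te TE cD.
- exists (seq_span e); split=> //.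
  + exact: creation_Oq be Te TE cD.
  + exact: creation_invT Te TE.
  + exact: creation_invA be Te TE cD.
- by split=> //; exists H, J, N; case: ext.
- by exists H, J, N.
Qed.

End Relations.

Theorem theorem21 (R : realType) (q : R) (hq : 1 <= q) (H : hilbertType R)
    (hH : exists x : H, x != 0) (S : operator H)
    (S_lin : linear_operator S) (S_dense : densely_defined S)
    (S_closable : closable S) :
  [/\ cond_i q S -> cond_ii q S,
      cond_ii q S -> cond_iii q S,
      cond_iii q S -> cond_iv q S,
      cond_iv q S -> cond_v q S &
      cond_v q S -> cond_i q S].
Proof.
split.
- exact: cond_i_ii.
- exact: cond_ii_iii.
- exact: cond_iii_iv.
- exact: cond_iv_v.
- exact: cond_v_i.
Qed.
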